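(* Let $k$ be a positive integer. (1) If $e=k(k-1)$, then $\rho(e)=k-1$. Moreover, for $D\in\mathcal{D}(e)$, $\rho(D)=\rho(e)=k-1$ if and only if $D$ is, apart from isolated vertices, the complete simple digraph $\overleftrightarrow{K_k}$. (2) If $e=k(k-1)+1$, then $\rho(e)=k-1$. Moreover, if $k>2$, then for $D\in\mathcal{D}(e)$, $\rho(D)=\rho(e)=k-1$ if and only if $D$ is, apart from isolated vertices, the complete simple digraph $\overleftrightarrow{K_k}$ with one additional arc. If $k=2$, then for $D\in\mathcal{D}(e)$, $\rho(D)=k-1$ if and only if $D$ is, apart from isolated vertices, an oriented triangle or the complete simple digraph $\overleftrightarrow{K_2}$ with one additional arc. (3) If $e=k(k-1)+2k-2$, then $\rho(e)=\frac{k-2+\sqrt{(k-2)^2+8(k-1)}}{2}$. Moreover, for $D\in\mathcal{D}(e)$, $\rho(D)=\rho(e)=\frac{k-2+\sqrt{(k-2)^2+8(k-1)}}{2}$ if and only if $D$ is, apart from isolated vertices, the digraph obtained from the complete simple digraph $\overleftrightarrow{K_{k+1}}$ by removing a complete simple digraph $\overleftrightarrow{K_2}$. (4) If $e=k(k-1)+2k-1$, then $\rho(e)=\frac{k-1+\sqrt{(k-1)^2+4(k-1)}}{2}$. Moreover, for $D\in\mathcal{D}(e)$, $\rho(D)=\rho(e)=\frac{k-1+\sqrt{(k-1)^2+4(k-1)}}{2}$ if and only if $D$ is, apart from isolated vertices, the digraph obtained from the complete simple digraph $\overleftrightarrow{K_{k+1}}$ by removing one arc.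
   Context: A simple digraph is a finite directed graph with no loops and no multiple arcs (a pair of opposite arcs $(u,v),(v,u)$ is allowed). The adjacency matrix $A(D)=(a_{ij})$ has $a_{ij}=1$ if there is an arc from $v_i$ to $v_j$ and $a_{ij}=0$ otherwise. The spectral radius $\rho(D)$ is the eigenvalue of $A(D)$ of largest modulus (a nonnegative real number, by Perron-Frobenius). $\mathcal{D}(e)$ is the set of all simple digraphs with exactly $e$ arcs (on any number of vertices), and $\rho(e)=\max\{\rho(D): D\in\mathcal{D}(e)\}$. $\overleftrightarrow{K_n}$ is the complete simple digraph on $n$ vertices: all $n(n-1)$ arcs $(u,v)$ with $u\ne v$. ''Removing a complete simple digraph $\overleftrightarrow{K_2}$'' from $\overleftrightarrow{K_{k+1}}$ means deleting the two opposite arcs between some pair of distinct vertices (the vertices are kept). ''$\overleftrightarrow{K_k}$ with one additional arc'' means a simple digraph whose arcs are those of a copy of $\overleftrightarrow{K_k}$ together with exactly one more arc, having at least one endpoint outside that copy (any such arc is allowed, including one with both endpoints outside). An oriented triangle is a directed cycle on three vertices. An isolated vertex is one with no incoming and no outgoing arcs. ''$D$ is, apart from isolated vertices, $H$'' means that $D$ and $H$ become isomorphic after all isolated vertices are deleted from both. *)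

(* Defs.v *)
From HB Require Import structures.
From mathcomp Require Import all_boot all_order all_algebra.
From mathcomp Require Import classical_sets reals complex.

Set Implicit Arguments.
Unset Strict Implicit.
Unset Printing Implicit Defensive.

Import Order.TTheory GRing.Theory Num.Theory.

Local Open Scope ring_scope.

Record digraph := Digraph {
  vertex :> finType;
  adj : rel vertex;
  adj_irrefl : irreflexive adj }.

Definition num_arcs (D : digraph) : nat :=
  #|[set p : D * D | adj p.1 p.2]|.

(* The vertices are numbered along [enum D]; the eigenvalues do not depend on
   the numbering. *)
Definition adj_matrix (C : nzRingType) (D : digraph) : 'M[C]_#|D| :=
  \matrix_(i, j) (adj (enum_val i) (enum_val j))%:R.

(* The largest modulus of a complex eigenvalue; the set below is finite, so the
   supremum is a maximum as soon as there is a vertex, and [sup set0 = 0] gives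
   the digraph without vertices spectral radius 0. *)
Definition spectral_radius (R : realType) (D : digraph) : R :=
  sup [set ComplexField.Normc.normc z | z in [set z : R[i] | eigenvalue (adj_matrix R[i] D) z]].

(* [r] is the maximum (attained) of the spectral radii of the simple digraphs
   with exactly [e] arcs, that is, rho(e) = r. *)
Definition max_spectral_radius (R : realType) (e : nat) (r : R) : Prop :=
  (exists D : digraph, num_arcs D = e /\ spectral_radius R D = r) /\
  (forall D : digraph, num_arcs D = e -> spectral_radius R D <= r).

Definition isolated (D : digraph) (x : D) : bool :=
  [forall y, ~~ adj x y && ~~ adj y x].

Section DeleteIsolated.
Variable D : digraph.
Let V : finType := {x : D | ~~ isolated x}.
Let a : rel V := fun x y => adj (val x) (val y).
Fact delete_isolated_irrefl : irreflexive a.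
Proof. by move=> x; apply: adj_irrefl. Qed.
Definition delete_isolated : digraph := Digraph delete_isolated_irrefl.
End DeleteIsolated.

Definition isomorphic (D H : digraph) : Prop :=
  exists f : D -> H, bijective f /\ forall x y, adj (f x) (f y) = adj x y.

Definition iso_up_to_isolated (D H : digraph) : Prop :=
  isomorphic (delete_isolated D) (delete_isolated H).

Fact complete_irrefl (n : nat) : irreflexive (fun x y : 'I_n => x != y).
Proof. by move=> x; rewrite eqxx. Qed.
Definition complete_digraph (n : nat) : digraph :=
  Digraph (@complete_irrefl n).

Section DeleteArcs.
Variables (D : digraph) (S : {set D * D}).
Let a : rel D := fun x y => adj x y && ((x, y) \notin S).
Fact delete_arcs_irrefl : irreflexive a.
Proof. by move=> x; rewrite /a adj_irrefl. Qed.
Definition delete_arcs : digraph := Digraph delete_arcs_irrefl.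
End DeleteArcs.

Definition complete_minus_K2 (n : nat) (u v : 'I_n) : digraph :=
  @delete_arcs (complete_digraph n) [set (u, v); (v, u)].

Definition complete_minus_arc (n : nat) (u v : 'I_n) : digraph :=
  @delete_arcs (complete_digraph n) [set (u, v)].

(* [S] is the vertex set of the copy of the complete digraph; vertices of [H]
   outside [S] that are not endpoints of the arc [(u, v)] are isolated. *)
Definition is_complete_plus_arc (k : nat) (H : digraph) : Prop :=
  exists (S : {set H}) (u v : H),
    [/\ #|S| = k, u != v, ~~ ((u \in S) && (v \in S)) &
        forall x y : H, adj x y =
          [&& x \in S, y \in S & x != y] || ((x, y) == (u, v))].

Fact oriented_triangle_irrefl :
  irreflexive (fun x y : 'I_3 => val y == (x.+1 %% 3)%N).
Proof. by case=> [[|[|[|]]]]. Qed.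
Definition oriented_triangle : digraph := Digraph oriented_triangle_irrefl.

(* Main.v *)
Require Import Defs.
From mathcomp Require Import all_boot all_order all_algebra.
From mathcomp Require Import classical_sets reals complex.
From mathcomp Require Import boolp fintype finset zify ring lra.

(** Why the theorem holds.  A complex eigenvector [w] of the adjacency matrix for
    an eigenvalue of modulus [rho], replaced by its entrywise moduli and scaled to
    maximum 1, gives weights [x] with [rho * x v <= \sum_(u in preds v) x u]
    ([subinvariant]).  These inequalities replace the whole of Perron-Frobenius
    theory: upper bounds only use them, and lower bounds come from explicit
    eigenvectors of the extremal digraphs.

    Let [m] be a vertex of weight 1.  Then [rho <= #|preds m|], and applying the
    inequality twice, [rho ^+ 2] is at most the number of arcs into [preds m].
    Arcs into [m] and arcs into [preds m] are different arcs, as there are no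
    loops, so [rho ^+ 2 + #|preds m| <= e].  With [n = k - 1] and [e = k * n] or
    [e = k * n + 1] the two inequalities give [rho <= n], and in the case of
    equality they force the weights and in-degrees around every vertex of weight
    1, hence the digraph ([complete_of_subinvariant],
    [plus_arc_of_subinvariant]).

    For [e = k * k.+1 - 1] the same two inequalities force [#|preds m| = k] when
    [rho] is as large as claimed.  Too few arcs are left for all [k] vertices of
    [preds m] to have in-degree [k]; one of them, [j], has in-degree at most
    [k - 1].  Its weight is at least [rho - (k - 1)] because of the inequality at
    [m], and at most [(k - 1) / rho] because of its own, which is the
    quadratic bound on [rho] ([minus_arc_of_subinvariant]).

    For [e = k * k.+1 - 2] one vertex is not enough.  Let [T] consist of [k.+1]
    vertices of largest weight, [s] its total weight and [c] a number between the
    weights inside and outside [T].  A set of [N] vertices weighs at most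
    [s + (N - k.+1) * c], so that [(rho + 1) * x v <= s + (#|preds v| - k) * c]
    for every [v].  Let [w] be the lightest vertex of [T].  If [w] has in-degree
    at least [k - 1], take [c = x w]; the sums of these inequalities over [T] and
    over [T :\ w] bound [c / s] from above and from below, and compatibility of
    the two bounds is the quadratic bound on [rho].  If the in-degree of [w] is
    smaller, then [x w] is too small: with [c] the largest weight outside [T],
    the sum over [T :\ w] gives [rho * (rho + 1 - k) <= k - 2], which is a strictly
    stronger bound ([minus_K2_of_subinvariant]). *)

Set Implicit Arguments.
Unset Strict Implicit.
Unset Printing Implicit Defensive.

Import Order.TTheory GRing.Theory Num.Theory.
Import ComplexField.Normc.

Local Open Scope ring_scope.

(** * The spectral radius and subinvariant weights *)

(** Eigenvectors of matrices are row vectors, so an eigenvector condition at [v]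
    sums over the arcs that enter [v]. *)
Definition preds (D : digraph) (v : D) : {set D} := [set u | adj u v].

Definition subinvariant (R : realType) (D : digraph) (r : R) (x : D -> R) :=
  [/\ forall v, 0 <= x v <= 1,
      exists v, x v = 1 &
      forall v, r * x v <= \sum_(u in preds v) x u].

Lemma normc_real (R : rcfType) (r : R) : 0 <= r -> normc (r%:C)%C = r.
Proof. by move=> r0; rewrite /normc /= expr0n /= addr0 sqrtr_sqr ger0_norm. Qed.

Lemma normc_ge0 (R : rcfType) (z : R[i]) : 0 <= normc z.
Proof. by case: z => a b; apply: sqrtr_ge0. Qed.

Lemma le_normc_sum (R : rcfType) (I : Type) (s : seq I) (P : pred I) (F : I -> R[i]) :
  normc (\sum_(i <- s | P i) F i) <= \sum_(i <- s | P i) normc (F i).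
Proof.
elim/big_ind2: _ => [|x1 x2 y1 y2 le1 le2|//]; first by rewrite normc0.
exact: le_trans (le_normcD _ _) (lerD le1 le2).
Qed.

Lemma seq_max_attained (R : realDomainType) (T : eqType) (f : T -> R) (s : seq T) :
  s != [::] -> exists2 z, z \in s & forall y, y \in s -> f y <= f z.
Proof.
elim: s => // a [|b s] IH _.
  by exists a; rewrite ?mem_head // => y; rewrite inE => /eqP ->.
have [//|z zs zmax] := IH.
have [az|/ltW za] := leP (f a) (f z).
  exists z; first by rewrite inE zs orbT.
  by move=> y; rewrite inE => /predU1P[-> //|/zmax].
exists a; first exact: mem_head.
move=> y; rewrite inE => /predU1P[-> //|/zmax yz]; exact: le_trans yz za.
Qed.

Section SpectralRadius.
Variable R : realType.

(** The eigenvalues are the roots of the characteristic polynomial, which splits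
    over [R[i]]; the finiteness of their set makes the supremum in
    [spectral_radius] a maximum. *)
Lemma eigenvalue_seq (D : digraph) :
  exists s : seq R[i], forall z, eigenvalue (adj_matrix R[i] D) z = (z \in s).
Proof.
have [s ds] := closed_field_poly_normal (char_poly (adj_matrix R[i] D)).
exists s => z; rewrite eigenvalue_root_char ds.
rewrite (monicP (char_poly_monic _)) scale1r.
exact: root_prod_XsubC.
Qed.

Lemma spectral_radius_max (D : digraph) :
  (forall z, eigenvalue (adj_matrix R[i] D) z -> normc z <= spectral_radius R D) /\
  (0 < spectral_radius R D ->
     exists2 z, eigenvalue (adj_matrix R[i] D) z & normc z = spectral_radius R D).
Proof.
have [s sE] := eigenvalue_seq D.
have [s0|s_neq0] := eqVneq s [::].
  split=> [z|]; first by rewrite sE s0.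
  rewrite /spectral_radius (_ : [set _ | _ in _]%classic = classical_sets.set0) ?sup0 ?ltxx //.
  by apply/seteqP; split=> // y [z /=]; rewrite sE s0.
have [z0 z0s z0max] := seq_max_attained (@normc R) s_neq0.
have -> : spectral_radius R D = normc z0.
  apply/eqP; rewrite eq_le; apply/andP; split.
    apply: ge_sup; first by exists (normc z0), z0; rewrite //= sE.
    by move=> _ [z /= zs <-]; apply: z0max; rewrite -sE.
  apply: ub_le_sup; last by exists z0; rewrite //= sE.
  by exists (normc z0) => _ [z /= zs <-]; apply: z0max; rewrite -sE.
split=> [z|_]; first by rewrite sE => /z0max.
by exists z0; rewrite ?sE.
Qed.

Lemma spectral_radius_ge0 (D : digraph) : 0 <= spectral_radius R D.
Proof.
have [ub _] := spectral_radius_max D.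
have [[z zE]|n0] := pselect (exists z, eigenvalue (adj_matrix R[i] D) z).
  by apply: le_trans (ub z zE); apply: normc_ge0.
rewrite /spectral_radius (_ : [set _ | _ in _]%classic = classical_sets.set0) ?sup0 //.
by apply/seteqP; split=> // y [z /= zE]; case: n0; exists z.
Qed.

Lemma sum_enum_val (V : nmodType) (T : finType) (F : T -> V) :
  \sum_(i < #|T|) F (enum_val i) = \sum_t F t.
Proof. by rewrite [RHS]big_enum_val. Qed.

(** The triangle inequality, applied to each coordinate of the eigenvector
    equation for an eigenvalue of maximal modulus. *)
Lemma spectral_radius_subinvariant (D : digraph) :
  0 < spectral_radius R D -> exists x, subinvariant (spectral_radius R D) (D:=D) x.
Proof.
move=> /(proj2 (spectral_radius_max D))[z zE <-].
have /eigenvalueP[w wE w0] := zE.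
pose y (d : D) : R := normc (w 0 (enum_rank d)).
have yE i : normc (w 0 i) = y (enum_val i) by rewrite /y enum_valK.
have [i wi0] : exists i, w 0 i != 0 by apply/rV0Pn.
pose m := [arg max_(v > enum_val i) y v]%O.
have mmax v : y v <= y m.
  by rewrite /m; case: arg_maxP => // j _; apply.
have ym0 : 0 < y m.
  apply: lt_le_trans (mmax (enum_val i)); rewrite -yE lt_def normc_ge0 andbT.
  by apply: contra wi0 => /eqP/eq0_normc ->.
exists (fun v => y v / y m); split.
- move=> v; rewrite divr_ge0 ?normc_ge0 //= ler_pdivrMr // mul1r; exact: mmax.
- by exists m; rewrite divff // gt_eqF.
move=> v; rewrite -mulr_suml mulrA ler_wpM2r ?invr_ge0 ?normc_ge0 //.
rewrite /y -normcM.
have /(congr1 (fun A : 'rV__ => A 0 (enum_rank v))) := wE.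
rewrite !mxE => <-; apply: le_trans (le_normc_sum _ _ _) _.
rewrite [leRHS](_ : _ = \sum_(u | adj u v) y u); last first.
  by apply: eq_bigl => u; rewrite inE.
rewrite [leRHS]big_mkcond -(sum_enum_val (fun u => if adj u v then y u else 0)).
apply: ler_sum => j _.
rewrite mxE enum_rankK normcM yE; case: (adj _ _).
  by rewrite normc1 mulr1.
by rewrite normc0 mulr0.
Qed.

Lemma le_spectral_radius (D : digraph) (r : R) (x : D -> R) :
  0 <= r -> (exists v, x v != 0) ->
  (forall v, \sum_(u in preds v) x u = r * x v) -> r <= spectral_radius R D.
Proof.
move=> r0 [v xv0] xE; have [ub _] := spectral_radius_max D.
rewrite -{1}(normc_real r0); apply: ub; apply/eigenvalueP.
exists (\row_i (x (enum_val i))%:C)%C; last first.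
  apply/rV0Pn; exists (enum_rank v); rewrite mxE enum_rankK.
  by apply: contra xv0 => /eqP[->].
apply/rowP=> j; rewrite !mxE -rmorphM -xE.
under eq_bigr do rewrite !mxE -(rmorph_nat (@real_complex R)) -rmorphM.
rewrite -rmorph_sum; congr (_%:C)%C.
rewrite (sum_enum_val (fun t => x t * (adj t (enum_val j))%:R)) [RHS]big_mkcond.
by apply: eq_bigr => t _; rewrite inE; case: adj; rewrite ?mulr1 ?mulr0.
Qed.

End SpectralRadius.

(** * In-degrees and vertices of maximal weight *)

Lemma eq_of_sum_le (R : realDomainType) (T : finType) (A : {set T}) (F G : T -> R) :
  (forall i, i \in A -> F i <= G i) ->
  \sum_(i in A) G i <= \sum_(i in A) F i -> forall i, i \in A -> F i = G i.
Proof.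
move=> leFG leGF i iA; apply/eqP; rewrite -subr_eq0 -oppr_eq0 opprB.
apply/eqP/(psumr_eq0P (P := mem A) (F := fun i => G i - F i)) => //.
  by move=> j jA; rewrite subr_ge0 leFG.
by apply/eqP; rewrite sumrB eq_le subr_le0 leGF subr_ge0 ler_sum.
Qed.

Lemma sum1_const (R : pzSemiRingType) (T : finType) (A : {set T}) :
  \sum_(i in A) 1 = #|A|%:R :> R.
Proof. by rewrite sumr_const. Qed.

Section Preds.
Variable D : digraph.
Implicit Types (u v m : D) (A : {set D}).

Lemma in_preds u v : (u \in preds v) = adj u v.
Proof. by rewrite inE. Qed.

Lemma notin_preds v : v \notin preds v.
Proof. by rewrite inE adj_irrefl. Qed.

Lemma card_cpreds v : #|v |: preds v| = #|preds v|.+1.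
Proof. by rewrite cardsU1 notin_preds. Qed.

Lemma num_arcsE : num_arcs D = (\sum_(v : D) #|preds v|)%N.
Proof.
rewrite /num_arcs -sum1_card (eq_bigl (fun p : D * D => true && adj p.1 p.2)).
  rewrite (eq_bigl (fun p : D * D => xpredT p.1 && adj p.1 p.2)) //.
  rewrite -(pair_big_dep xpredT (fun u v => adj u v) (fun _ _ => 1%N)) /=.
  rewrite (exchange_big_dep xpredT) //=; apply: eq_bigr => v _.
  by rewrite -sum1_card; apply: eq_bigl => u; rewrite inE.
by move=> p; rewrite inE.
Qed.

Definition arcs_to (A : {set D}) : nat := (\sum_(v in A) #|preds v|)%N.

Lemma arcs_to_setC A : num_arcs D = (arcs_to A + arcs_to (~: A))%N.
Proof.
rewrite num_arcsE (bigID (mem A)) /=; congr (_ + _)%N.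
by apply: eq_bigl => v; rewrite inE.
Qed.

Lemma arcs_to_U1 v A : v \notin A -> arcs_to (v |: A) = (#|preds v| + arcs_to A)%N.
Proof. exact: big_setU1. Qed.

Lemma arcs_to_D1 v A : v \in A -> arcs_to A = (#|preds v| + arcs_to (A :\ v))%N.
Proof. exact: big_setD1. Qed.

Lemma arcs_to_const c (A : {set D}) : (forall v, v \in A -> #|preds v| = c) ->
  arcs_to A = (#|A| * c)%N.
Proof.
by move=> h; rewrite /arcs_to (eq_bigr (fun=> c)) ?sum_nat_const.
Qed.

(** The arcs into [v], into its predecessors and into the other vertices are three
    separate families, because [v] is not its own predecessor. *)
Lemma num_arcs_cpreds v : num_arcs D =
  (#|preds v| + arcs_to (preds v) + arcs_to (~: (v |: preds v)))%N.
Proof. by rewrite (arcs_to_setC (v |: preds v)) arcs_to_U1 ?notin_preds. Qed.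

Lemma arcs_to_eq0 A : arcs_to A = 0%N -> forall v, v \in A -> preds v = set0.
Proof.
by move=> /eqP; rewrite sum_nat_eq0 => /forall_inP h v /h; rewrite cards_eq0 => /eqP.
Qed.

Lemma natr_arcs_to (R : nzSemiRingType) A :
  (arcs_to A)%:R = \sum_(v in A) #|preds v|%:R :> R.
Proof. exact: natr_sum. Qed.

End Preds.

Section Subinvariant.
Variables (R : realType) (D : digraph) (r : R) (x : D -> R).
Hypotheses (r_gt0 : 0 < r) (subx : subinvariant r x).

Lemma subinv_ge0 v : 0 <= x v.
Proof. by case: subx => /(_ v)/andP[]. Qed.

Lemma subinv_le1 v : x v <= 1.
Proof. by case: subx => /(_ v)/andP[]. Qed.

Lemma subinvP v : r * x v <= \sum_(u in preds v) x u.
Proof. by case: subx. Qed.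

Lemma sum_le_card (A : {set D}) : \sum_(u in A) x u <= #|A|%:R.
Proof. by rewrite -sum1_const ler_sum // => u _; apply: subinv_le1. Qed.

Lemma card_le_sum (A : {set D}) : #|A|%:R <= \sum_(u in A) x u -> forall u, u \in A -> x u = 1.
Proof.
rewrite -sum1_const; apply: eq_of_sum_le => u _; exact: subinv_le1.
Qed.

Lemma subinv_le_indegree v : r * x v <= #|preds v|%:R.
Proof. exact: le_trans (subinvP v) (sum_le_card _). Qed.

Lemma subinv_preds0 v : preds v = set0 -> x v = 0.
Proof.
move=> v0; apply/eqP; rewrite eq_le subinv_ge0 andbT.
by have := subinv_le_indegree v; rewrite v0 cards0 pmulr_rle0.
Qed.

Section Maximal.
Variable m : D.
Hypothesis xm : x m = 1.

Lemma max_le_sum : r <= \sum_(u in preds m) x u.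
Proof. by have := subinvP m; rewrite xm mulr1. Qed.

Lemma max_le_indegree : r <= #|preds m|%:R.
Proof. exact: le_trans max_le_sum (sum_le_card _). Qed.

Lemma max_sqr_le_sum : r ^+ 2 <= \sum_(u in preds m) r * x u.
Proof. by rewrite -mulr_sumr expr2 ler_pM2l // max_le_sum. Qed.

(** Two steps of the inequality: each predecessor [u] of [m] contributes
    [r * x u], which is at most its in-degree. *)
Lemma max_sqr_le : r ^+ 2 <= (arcs_to (preds m))%:R.
Proof.
apply: le_trans max_sqr_le_sum _; rewrite natr_arcs_to.
by apply: ler_sum => u _; apply: subinv_le_indegree.
Qed.

Lemma max_preds_tight : #|preds m|%:R <= r -> forall u, u \in preds m -> x u = 1.
Proof. by move=> h; apply/card_le_sum/(le_trans h)/max_le_sum. Qed.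

(** If the bound of [max_sqr_le] is attained, every inequality on the way to it is
    an equality, which determines the weights two steps back from [m]. *)
Lemma max_arcs_tight : (arcs_to (preds m))%:R <= r ^+ 2 ->
  [/\ \sum_(u in preds m) x u = r,
      forall u, u \in preds m -> r * x u = #|preds u|%:R &
      forall u w, u \in preds m -> w \in preds u -> x w = 1].
Proof.
move=> h; have rE : forall u, u \in preds m -> r * x u = #|preds u|%:R.
  apply: eq_of_sum_le => [u _|]; first exact: subinv_le_indegree.
  by rewrite -natr_arcs_to; apply: le_trans h max_sqr_le_sum.
split=> //.
  apply: (mulfI (lt0r_neq0 r_gt0)); rewrite -expr2 mulr_sumr.
  apply/eqP; rewrite eq_le max_sqr_le_sum andbT.
  by rewrite (eq_bigr _ rE) -natr_arcs_to.
by move=> u w um; apply: card_le_sum; rewrite -rE //; apply: subinvP.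
Qed.

End Maximal.

Lemma max_preds_gt0 m : x m = 1 -> preds m != set0.
Proof.
by move=> xm; apply/eqP => /subinv_preds0/eqP; rewrite xm oner_eq0.
Qed.

End Subinvariant.

(** * The complete digraph, alone and with one additional arc *)

Section SmallExcess.
Variables (R : realType) (D : digraph).
Implicit Types (u v m w : D) (T : {set D}).

Lemma arcs_to_eq1 T : arcs_to T = 1%N ->
  exists v u, [/\ v \in T, preds v = [set u] & forall w, w \in T -> w != v -> preds w = set0].
Proof.
move=> T1; have [v vT v_gt0] : exists2 v, v \in T & (0 < #|preds v|)%N.
  apply/exists_inP; apply: contraPT T1 => /exists_inPn h.
  rewrite /arcs_to big1 // => v /h; rewrite lt0n negbK => /eqP //.
have := arcs_to_D1 vT; rewrite T1 => T1'.
have /eqP/cards1P[u uE] : #|preds v| = 1%N by lia.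
have /arcs_to_eq0 h : arcs_to (T :\ v) = 0%N by lia.
by exists v, u; split=> // w wT wv; apply: h; rewrite !inE wv.
Qed.

Lemma adj_of_clique T : (forall v, v \in T -> v |: preds v = T) ->
  forall u v, v \in T -> adj u v = (u \in T) && (u != v).
Proof.
move=> h u v /h; move=> <-; rewrite !inE.
by case: eqVneq => [->|_]; rewrite ?adj_irrefl ?andbT.
Qed.

(** Adding [n <= #|preds m|] and [n ^ 2 <= arcs_to (preds m)] already accounts for
    all [n.+1 * n] arcs.  So around a vertex [m] of weight 1 all weights are 1 and
    no arc enters a vertex outside [m |: preds m]; as this applies to every vertex
    of [m |: preds m], these closed neighbourhoods all coincide. *)
Lemma complete_of_subinvariant n (x : D -> R) : (0 < n)%N ->
  num_arcs D = (n.+1 * n)%N -> subinvariant n%:R x ->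
  exists T : {set D}, #|T| = n.+1 /\
    forall u v, adj u v = [&& u \in T, v \in T & u != v].
Proof.
move=> n_gt0 eD subx; have n0 : 0 < n%:R :> R by rewrite ltr0n.
have key m : x m = 1 -> [/\ #|preds m| = n, forall u, u \in preds m -> x u = 1 &
    forall u, u \notin m |: preds m -> preds u = set0].
  move=> xm; have := max_le_indegree subx xm; rewrite ler_nat => le1.
  have := max_sqr_le n0 subx xm; rewrite -natrX ler_nat => le2.
  have eqe := num_arcs_cpreds m; rewrite eD in eqe.
  have dm : #|preds m| = n by nia.
  split=> //; first by apply: (max_preds_tight subx xm); rewrite dm.
  move=> u um; apply: (@arcs_to_eq0 _ (~: (m |: preds m))); last by rewrite inE.
  nia.
have [_ [m xm] _] := subx.
have [dm xPm out] := key m xm; pose T := m |: preds m.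
have xT u : u \in T -> x u = 1 by rewrite !inE -in_preds => /predU1P[->|/xPm].
have NT v : v \in T -> v |: preds v = T.
  move=> vT; have [dv _ outv] := key v (xT v vT).
  apply/esym/eqP; rewrite eqEcard !card_cpreds dv dm leqnn andbT.
  apply/subsetP => w wT; apply: contraT => /outv /eqP.
  by rewrite (negPf (max_preds_gt0 n0 subx (xT w wT))).
exists T; split; first by rewrite card_cpreds dm.
move=> u v; case: (boolP (v \in T)) => [vT|/out v0]; first exact: adj_of_clique.
by rewrite -in_preds v0 !inE andbF.
Qed.

(** A vertex of weight 1 has in-degree [n] or [n.+1].

    If one, [m], has in-degree [n.+1], the arc count is again exhausted; the
    vertices of weight 1 form a complete digraph on [n.+1] vertices that contains
    [m], and the last predecessor of [m] is the tail of the additional arc.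

    Otherwise each vertex of weight 1 has [n] predecessors, all of weight 1, and
    exactly one arc enters a vertex outside its closed neighbourhood.  Either some
    closed neighbourhood is a complete digraph, or two of them differ; in the
    latter case a vertex of the difference absorbs [n] arcs where only one is
    left, so [n = 1], and following the predecessors closes up into a triangle. *)
Lemma plus_arc_of_subinvariant n (x : D -> R) : (0 < n)%N ->
  num_arcs D = (n.+1 * n + 1)%N -> subinvariant n%:R x ->
  is_complete_plus_arc n.+1 D \/
  n = 1%N /\ exists a b c, [/\ preds a = [set b], preds b = [set c], preds c = [set a],
    uniq [:: a; b; c] & forall v, v \notin [:: a; b; c] -> preds v = set0].
Proof.
move=> n_gt0 eD subx; have n0 : 0 < n%:R :> R by rewrite ltr0n.
have degs m : x m = 1 -> (n <= #|preds m| <= n.+1)%N.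
  move=> xm; have := max_le_indegree subx xm; rewrite ler_nat => le1.
  have := max_sqr_le n0 subx xm; rewrite -natrX ler_nat => le2.
  have eqe := num_arcs_cpreds m; rewrite eD in eqe.
  nia.
have [[m [xm dm]]|nodm] := pselect (exists m, x m = 1 /\ #|preds m| = n.+1).
  have le2 := max_sqr_le n0 subx xm; rewrite -natrX ler_nat in le2.
  have eqe := num_arcs_cpreds m; rewrite eD in eqe.
  have dPm : arcs_to (preds m) = (n ^ 2)%N by nia.
  have out u : u \notin m |: preds m -> preds u = set0.
    move=> um; apply: (@arcs_to_eq0 _ (~: (m |: preds m))); last by rewrite inE.
    nia.
  have [|sumx xP xPP] := max_arcs_tight n0 subx xm.
    by rewrite dPm natrX.
  pose M := [set v | x v == 1].
  have inM v : (v \in M) = (x v == 1) by rewrite inE.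
  have MN : M \subset m |: preds m.
    apply/subsetP => v; rewrite inM => /eqP xv; apply: contraT => /out /eqP.
    by rewrite (negPf (max_preds_gt0 n0 subx xv)).
  have PM u : u \in preds m -> preds u \subset M.
    by move=> um; apply/subsetP => w /(xPP _ _ um) xw; rewrite inM xw.
  have dM u : u \in preds m -> u \in M -> #|preds u| = n.
    move=> um; rewrite inM => /eqP xu; have := xP u um.
    by rewrite xu mulr1 => /eqP; rewrite eqr_nat eq_sym => /eqP.
  (* The predecessors of [m] cannot all have weight below 1: each would then have
     in-degree below [n], and also at most 1 since only [m] could precede it, but
     together they receive [n ^ 2] arcs. *)
  have [u0 u0m u0M] : exists2 u, u \in preds m & u \in M.
    apply/exists_inP; apply: contraT => /exists_inPn h.
    have small u : u \in preds m -> (#|preds u| <= minn 1 n.-1)%N.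
      move=> um; have um' := h u um; rewrite leq_min; apply/andP; split.
        rewrite -(cards1 m) subset_leq_card //.
        apply/subsetP => w wu; have wM := subsetP (PM u um) w wu.
        have := subsetP MN w wM; rewrite !inE -in_preds => /predU1P[->|/h]; rewrite ?eqxx //.
        by rewrite wM.
      have xu : x u < 1 by rewrite lt_neqAle -inM um' (subinv_le1 subx).
      rewrite -ltnS prednK // -(ltr_nat R) -xP //.
      by rewrite -subr_gt0 -{1}[n%:R]mulr1 -mulrBr mulr_gt0 // subr_gt0.
    have : (arcs_to (preds m) <= #|preds m| * minn 1 n.-1)%N.
      by rewrite -sum_nat_const; apply: leq_sum.
    rewrite dPm dm; have [->|] : n = 1%N \/ (1 < n)%N by lia.
      by [].
    nia.
  have du0 := dM u0 u0m u0M.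
  have MM : u0 |: preds u0 = M.
    apply/eqP; rewrite eqEcard subUset sub1set u0M PM //= card_cpreds du0.
    rewrite leqNgt; apply/negP => ltM.
    have /eqP eqM : M == m |: preds m.
      by rewrite eqEcard MN card_cpreds dm.
    move: sumx; rewrite (eq_bigr (fun=> 1)).
      by rewrite sum1_const dm => /eqP; rewrite eqr_nat; lia.
    by move=> u um; apply/eqP; rewrite -inM eqM !inE -in_preds um orbT.
  have cM : #|M| = n.+1 by rewrite -MM card_cpreds du0.
  have mM : m \in M by rewrite inM xm.
  have [w wE] : exists w, (m |: preds m) :\: M = [set w].
    apply/cards1P; rewrite cardsD (setIidPr MN) card_cpreds dm cM; lia.
  have /andP[wM wN] : (w \notin M) && (w \in m |: preds m).
    by have := set11 w; rewrite -wE inE.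
  have wm : w \in preds m.
    move: wN; rewrite !inE -in_preds => /predU1P[wm|//].
    by rewrite wm mM in wM.
  have Pm : preds m = w |: (M :\ m).
    apply/eqP; rewrite eqEcard cardsU1 in_setD1 (negPf wM) andbF dm.
    rewrite (cardsD1 m M) mM /= add1n in cM; case: cM => ->; rewrite leqnn andbT.
    apply/subsetP => v vm; rewrite in_setU1 in_setD1.
    have -> /= : v != m by apply: contraTneq vm => ->; rewrite notin_preds.
    have [//|vw /=] := eqVneq v w; apply: contraT => vM.
    have : v \in (m |: preds m) :\: M by rewrite in_setD vM in_setU1 vm orbT.
    by rewrite wE inE (negPf vw).
  have xw : x w = 0.
    move: sumx; rewrite Pm big_setU1 ?in_setD1 ?(negPf wM) ?andbF //=.
    rewrite (eq_bigr (fun=> 1)); last by move=> v; rewrite in_setD1 inM => /andP[_ /eqP].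
    rewrite sum1_const (_ : #|M :\ m| = n).
      by move/eqP; rewrite -subr_eq0 addrK => /eqP.
    by rewrite (cardsD1 m) mM in cM; lia.
  have Pw : preds w = set0.
    apply/eqP; rewrite -cards_eq0 -(eqr_nat R) -xP // xw mulr0 //.
  left; exists M, w, m; split=> //.
  - by apply: contraNneq wM => ->.
  - by rewrite (negPf wM).
  move=> u v; rewrite -in_preds xpair_eqE.
  have [->|vm] := eqVneq v m.
    by rewrite Pm in_setU1 in_setD1 mM andbT orbC [X in X || _ = _]andbC.
  rewrite andbF orbF.
  have [vM|vM] := boolP (v \in M); last first.
    rewrite andbF; have [->|vw] := eqVneq v w; first by rewrite Pw inE.
    rewrite out ?inE //; apply/negP => vN.
    have : v \in (m |: preds m) :\: M by rewrite inE vM !inE.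
    by rewrite wE inE (negPf vw).
  have vPm : v \in preds m.
    by have := subsetP MN v vM; rewrite !inE (negPf vm).
  have -> : preds v = M :\ v.
    apply/eqP; rewrite eqEcard; apply/andP; split.
      apply/subsetP => z zv; rewrite in_setD1 (subsetP (PM v vPm)) // andbT.
      by apply: contraTneq zv => ->; rewrite notin_preds.
    by move: cM; rewrite (cardsD1 v) vM add1n (dM v) // => -[->].
  by rewrite in_setD1 andbC.
have key m : x m = 1 -> [/\ #|preds m| = n, forall u, u \in preds m -> x u = 1 &
    arcs_to (~: (m |: preds m)) = 1%N].
  have dn v : x v = 1 -> #|preds v| = n.
    move=> xv; have /andP[le1 le2] := degs v xv; apply/eqP; rewrite eqn_leq le1 andbT.
    by rewrite -ltnS ltn_neqAle le2 andbT; apply/eqP => dv; apply: nodm; exists v.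
  move=> xm; have dm := dn m xm.
  have xPm : forall u, u \in preds m -> x u = 1.
    by apply: (max_preds_tight subx xm); rewrite dm.
  split=> //; have eqe := num_arcs_cpreds m; rewrite eD dm in eqe.
  have : arcs_to (preds m) = (n * n)%N.
    by rewrite -{1}dm; apply: arcs_to_const => u /xPm /dn.
  nia.
have xN m : x m = 1 -> forall u, u \in m |: preds m -> x u = 1.
  move=> xm u; have [_ xPm _] := key m xm.
  by rewrite !inE -in_preds => /predU1P[->|/xPm].
have [[m [xm mT]]|noclique] := pselect (exists m, x m = 1 /\
    forall u, u \in m |: preds m -> u |: preds u = m |: preds m).
  have [dm _ /arcs_to_eq1[v [u [vT Pv out]]]] := key m xm.
  left; exists (m |: preds m), u, v; rewrite inE in vT; split=> //.
  - by rewrite card_cpreds dm.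
  - by apply: contraTneq (set11 u) => uv; rewrite -Pv uv notin_preds.
  - by rewrite (negPf vT) andbF.
  move=> y z; rewrite xpair_eqE; have [zT|zT] := boolP (z \in m |: preds m).
    rewrite (negPf (_ : z != v)) ?andbF; last by apply: contraNneq vT => <-.
    by rewrite (adj_of_clique mT) //= orbF.
  rewrite andbF /=; have [->|zv] := eqVneq z v.
    by rewrite -in_preds Pv inE andbT.
  by rewrite -in_preds (out z _ zv) ?in_set0 ?andbF // in_setC.
(* A closed neighbourhood other than [m |: preds m] leaves out a vertex [w] of the
   latter, whose [n] incoming arcs have to be the single arc left over.  For
   [n = 1], coming back to [m] in two steps would make [m |: preds m] a clique. *)
have far m : x m = 1 -> n = 1%N /\ exists a b, [/\ x a = 1, x b = 1,
    preds m = [set a], preds a = [set b] & b != m].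
  move=> xm; have [dm xPm out1] := key m xm.
  have [u uT uN] : exists2 u, u \in m |: preds m & u |: preds u != m |: preds m.
    apply/exists_inP; apply: contraT => /exists_inPn h; case: noclique.
    by exists m; split=> // u /h; rewrite negbK => /eqP.
  have xu := xN m xm u uT; have [du xPu outu] := key u xu.
  have [w wm wu] : exists2 w, w \in m |: preds m & w \notin u |: preds u.
    apply/subsetPn; apply: contra uN => h; rewrite eq_sym eqEcard h.
    by rewrite !card_cpreds du dm leqnn.
  have wC : w \in ~: (u |: preds u) by rewrite in_setC.
  have n1 : n = 1%N.
    have [dw _ _] := key w (xN m xm w wm).
    by have := arcs_to_D1 wC; rewrite outu dw; lia.
  split=> //; have /eqP/cards1P[a aE] : #|preds m| = 1%N by rewrite dm.
  have am : a \in preds m by rewrite aE set11.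
  have xa := xPm a am; have [da xPa _] := key a xa.
  have /eqP/cards1P[b bE] : #|preds a| = 1%N by rewrite da.
  exists a, b; split=> //; first by apply: xPa; rewrite bE set11.
  apply: contra uN => /eqP bm; move: uT; rewrite in_setU1 => /predU1P[->//|].
  by rewrite aE => /set1P ->; rewrite bE bm setUC.
have [_ [m xm] _] := subx.
have [n1 [a [b [xa xb Pm Pa bm]]]] := far m xm.
have [_ [b' [c [_ xc]]]] := far a xa; rewrite Pa => /set1_inj bb' Pb ca.
rewrite -{b'}bb' in Pb xc.
have am : a != m by apply: contraTneq (set11 a) => eqa; rewrite -Pm -eqa notin_preds.
have ba : b != a by apply: contraTneq (set11 b) => eqa; rewrite -Pa -eqa notin_preds.
have mab : uniq [:: m; a; b] by rewrite /= !inE negb_or eq_sym am eq_sym bm eq_sym ba.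
have out v : v \notin [:: m; a; b] -> preds v = set0.
  have h := arcs_to_setC (m |: (a |: [set b])).
  have m_ab : m \notin a |: [set b] by rewrite !inE negb_or ![m == _]eq_sym am.
  have a_b : a \notin [set b] by rewrite !inE eq_sym.
  rewrite (arcs_to_U1 m_ab) (arcs_to_U1 a_b) {1}/arcs_to big_set1 in h.
  rewrite Pm Pa Pb !cards1 eD n1 in h.
  have /arcs_to_eq0 out : arcs_to (~: (m |: (a |: [set b]))) = 0%N by lia.
  by move=> vm; apply: out; move: vm; rewrite !inE !negb_or.
right; split=> //; exists m, a, b; split=> //; rewrite Pb; congr [set _].
apply: contraTeq (max_preds_gt0 n0 subx xc) => cm; rewrite negbK; apply/eqP/out.
rewrite !inE !negb_or ca /=; apply/andP; split.
  by apply: contraNneq cm => ->.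
by apply: contraTneq (set11 c) => eqa; rewrite -Pb -eqa notin_preds.
Qed.

End SmallExcess.

(** * The complete digraph without one arc *)

Definition clique_minus (D : digraph) (T : {set D}) (M : {set D * D}) :=
  forall u v : D, adj u v = [&& u \in T, v \in T, u != v & (u, v) \notin M].

Section MissingOneArc.
Variables (R : realType) (D : digraph) (k : nat) (r : R) (x : D -> R).
Hypotheses (k_gt1 : (1 < k)%N) (eD : (num_arcs D + 1 = k * k.+1)%N).
Hypotheses (r_gt0 : 0 < r) (subx : subinvariant r x).
Hypothesis r_large : (k%:R - 1) * (r + 1) <= r ^+ 2.
Implicit Types (u v m w : D).

(** [r_large] says that [r] is at least the larger root of
    [X ^+ 2 - (k - 1) * (X + 1)]; the conclusion that it is a root comes from the
    predecessor [j] of [m] of in-degree below [k], as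
    [r - (k - 1) <= x j <= (k - 1) / r]. *)
Lemma minus_arc_of_subinvariant :
  r ^+ 2 = (k%:R - 1) * (r + 1) /\
  exists (T : {set D}) b j, [/\ #|T| = k.+1, b \in T, j \in T, b != j &
    clique_minus T [set (b, j)]].
Proof.
have K2 : 2 <= k%:R :> R by rewrite (ler_nat _ 2).
have rK1 : k%:R - 1 < r.
  rewrite ltNge; apply/negP => rK.
  have := ler_wpM2l (ltW r_gt0) rK; move: r_large; rewrite expr2; nra.
have eR : (num_arcs D)%:R = k%:R ^+ 2 + k%:R - 1 :> R.
  have := congr1 (fun n => n%:R : R) eD; rewrite natrD natrM -[k.+1]addn1 natrD; lra.
have key m : x m = 1 -> r < k%:R /\ #|preds m| = k.
  move=> xm; have le1 := max_le_indegree subx xm.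
  have le2 := max_sqr_le r_gt0 subx xm.
  have eqe := num_arcs_cpreds m.
  have : (#|preds m| + arcs_to (preds m))%:R <= (num_arcs D)%:R :> R.
    by rewrite ler_nat eqe leq_addr.
  rewrite eR natrD => le3.
  have rK : r < k%:R.
    by rewrite ltNge; apply/negP => Kr; have := ler_pM (ler0n _ _) (ler0n _ _) Kr Kr; lra.
  split=> //; apply/eqP; rewrite eqn_leq; apply/andP; split; last first.
    have : k%:R < (#|preds m| + 1)%:R :> R by rewrite natrD; lra.
    by rewrite ltr_nat; lia.
  rewrite leqNgt; apply/negP => dm.
  have : k%:R + 1 <= #|preds m|%:R :> R by rewrite natr1 ler_nat.
  (* A vertex of weight 1 and in-degree above [k] would give [r ^+ 2 <= k ^ 2 - 2];
     with [r_large] this makes [(k - r) * (2 - (k - r))] nonpositive. *)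
  have g1 : 0 < k%:R - r by lra.
  have g2 : 0 < 2 - (k%:R - r) by lra.
  have := mulr_gt0 g1 g2; move: r_large; lra.
have low m : x m = 1 -> exists2 j, j \in preds m &
    [/\ r ^+ 2 = (k%:R - 1) * (r + 1) /\ #|preds j| = k.-1, x j < 1,
        (forall u, u \in preds m :\ j -> x u = 1),
        (forall u, u \in preds j -> x u = 1) &
        forall u, u \notin m |: preds m -> preds u = set0].
  move=> xm; have [rK dm] := key m xm.
  have eqe := num_arcs_cpreds m.
  have [j jm dj] : exists2 j, j \in preds m & (#|preds j| <= k.-1)%N.
    apply/exists_inP; apply: contraT => /exists_inPn h.
    have : (#|preds m| * k <= arcs_to (preds m))%N.
      by rewrite -sum_nat_const; apply: leq_sum => u /h; lia.
    by rewrite dm; nia.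
  have djR : #|preds j|%:R <= k%:R - 1 :> R.
    by rewrite -subn1 -(ler_nat R) natrB in dj; lia || lra.
  have cj : #|preds m :\ j|%:R = k%:R - 1 :> R.
    have := congr1 (fun n => n%:R : R) dm; rewrite /= (cardsD1 j) jm natrD /=; lra.
  have s1 := max_le_sum subx xm; rewrite (big_setD1 j jm) /= in s1.
  have s2 := sum_le_card subx (preds m :\ j); rewrite cj in s2.
  have s3 := subinv_le_indegree subx j.
  have xj_ge : r - k%:R + 1 <= x j by lra.
  have rxj := ler_wpM2l (ltW r_gt0) xj_ge.
  have rE : r ^+ 2 = (k%:R - 1) * (r + 1).
    by apply/le_anti; rewrite r_large andbT; lra.
  have xjE : x j = r - k%:R + 1.
    by apply: (mulfI (lt0r_neq0 r_gt0)); apply/le_anti; rewrite rxj andbT; lra.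
  have xj1 : x j < 1 by lra.
  have xPm u : u \in preds m :\ j -> x u = 1.
    by apply: (card_le_sum subx); rewrite cj; lra.
  have xPj u : u \in preds j -> x u = 1.
    apply: (card_le_sum subx); apply: le_trans (subinvP subx j).
    by rewrite xjE; nra.
  have dmax u : u \in preds m :\ j -> #|preds u| = k.
    by move=> /xPm /key[].
  have cj' : #|preds m :\ j| = k.-1.
    by apply/eqP; rewrite -(eqr_nat R) cj -subn1 natrB // ltnW.
  have dj' : #|preds j| = k.-1.
    apply/eqP; rewrite eqn_leq dj -(ler_nat R) -subn1 natrB 1?ltnW //.
    by apply: le_trans s3; rewrite xjE; nra.
  have O0 : arcs_to (~: (m |: preds m)) = 0%N.
    rewrite (arcs_to_D1 jm) (arcs_to_const dmax) cj' dm dj' in eqe.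
    by move: k_gt1 eD; rewrite eqe; clear; case: k => // k' _ /=; nia.
  exists j => //; split=> // u um.
  by apply: (arcs_to_eq0 O0); rewrite in_setC.
have [_ [m xm] _] := subx.
have [rK dm] := key m xm.
have [j jm [[rE dj] xj xPm xPj out]] := low m xm; split=> //.
pose T := m |: preds m; have cT : #|T| = k.+1 by rewrite card_cpreds dm.
have jT : j \in T by rewrite in_setU1 jm orbT.
have xT u : u \in T -> u != j -> x u = 1.
  rewrite in_setU1 => /predU1P[->//|um] uj.
  by apply: xPm; rewrite in_setD1 uj.
have PT u : u \in T -> preds u != set0.
  move=> uT; have [->|uj] := eqVneq u j.
    by rewrite -cards_eq0 dj -lt0n -subn1 subn_gt0.
  exact: (max_preds_gt0 r_gt0 subx (xT u uT uj)).
(* [j] is the only vertex of [T] whose weight is not 1; around the others the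
   arc count confines everything to [T]. *)
have NT v : v \in T -> v != j -> v |: preds v = T.
  move=> vT vj; have xv := xT v vT vj; have [_ dv] := key v xv.
  have [_ _ [_ _ _ _ outv]] := low v xv.
  apply/esym/eqP; rewrite eqEcard cT card_cpreds dv leqnn andbT.
  by apply/subsetP => u /PT; apply: contraR => /outv ->.
have Pj : preds j \subset T :\ j.
  apply/subsetP => u uj; have xu := xPj u uj; rewrite in_setD1.
  apply/andP; split; first by apply: contraTneq uj => ->; rewrite notin_preds.
  by apply: contraT => /out /eqP; rewrite (negPf (max_preds_gt0 r_gt0 subx xu)).
have [b bE] : exists b, (T :\ j) :\: preds j = [set b].
  apply/cards1P; rewrite cardsD (setIidPr Pj) dj.
  by move: cT k_gt1; rewrite (cardsD1 j) jT; clear; lia.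
have : b \in (T :\ j) :\: preds j by rewrite bE set11.
rewrite in_setD in_setD1 => /and3P[bPj bj bT].
exists T, b, j; split=> // u v; rewrite in_set1 xpair_eqE.
have [vT|/out v0] := boolP (v \in T); last by rewrite -in_preds v0 in_set0 andbF.
have [->|vj] := eqVneq v j; last first.
  rewrite -in_preds andbF andbT /=; rewrite -(NT v vT vj) in_setU1.
  by have [->|_] := eqVneq u v; rewrite ?(negPf (notin_preds _)) //= andbT.
have := in_set1 u b; rewrite -bE in_setD in_setD1 in_preds andbT /= => <-.
rewrite negb_and negbK /= negb_and negbK.
case uj : (adj u j) => /=; last by case: (u == j); case: (u \in T).
by have := subsetP Pj u; rewrite in_setD1 in_preds uj => /(_ isT)/andP[-> ->].
Qed.

End MissingOneArc.

(** * The complete digraph without two arcs *)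

Lemma top_subset (R : realDomainType) (T : finType) (f : T -> R) n : (n <= #|T|)%N ->
  exists A : {set T}, #|A| = n /\ forall u v, u \in A -> v \notin A -> f v <= f u.
Proof.
elim: n => [|n IH] nT; first by exists set0; rewrite cards0; split=> // u v; rewrite inE.
have [A [cA topA]] := IH (ltnW nT).
have [w wA] : exists w, w \in ~: A.
  by apply/set0Pn; rewrite -cards_eq0 -lt0n; have := cardsC A; lia.
pose z := [arg max_(v > w in ~: A) f v]%O.
have [zA zmax] : z \in ~: A /\ forall v, v \in ~: A -> f v <= f z.
  by rewrite /z; case: arg_maxP.
rewrite in_setC in zA; exists (z |: A); rewrite cardsU1 zA cA; split=> // u v.
rewrite !in_setU1 negb_or => /predU1P[->|uA] /andP[_ vA]; last exact: topA.
by apply: zmax; rewrite in_setC.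
Qed.

(** Once [c] is subtracted from every weight, the vertices of [A] contribute
    nonnegatively and all others nonpositively. *)
Lemma sum_le_top (R : realDomainType) (T : finType) (f : T -> R) (A N : {set T}) c :
  (forall u, u \in A -> c <= f u) -> (forall u, u \notin A -> f u <= c) ->
  \sum_(u in N) f u <= \sum_(u in A) f u + (#|N|%:R - #|A|%:R) * c.
Proof.
move=> geA leA.
have centre (B : {set T}) : \sum_(u in B) (f u - c) = \sum_(u in B) f u - #|B|%:R * c.
  by rewrite sumrB sumr_const mulr_natl.
suff : \sum_(u in N) (f u - c) <= \sum_(u in A) (f u - c).
  by rewrite !centre; lra.
rewrite (big_setID A) /= [leRHS](big_setID N) /= setIC lerD //.
apply: le_trans (_ : 0 <= _).
  by apply: sumr_le0 => u; rewrite inE subr_le0 => /andP[/leA].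
by apply: sumr_ge0 => u; rewrite inE subr_ge0 => /andP[_ /geA].
Qed.

Lemma num_arcs_le (D : digraph) : (num_arcs D <= #|D| * #|D|.-1)%N.
Proof.
rewrite num_arcsE -sum_nat_const; apply: leq_sum => v _.
have := max_card (mem (v |: preds v)).
rewrite card_cpreds; lia.
Qed.

Section MissingTwoArcs.
Variables (R : realType) (D : digraph) (k : nat) (r : R) (x : D -> R).
Hypotheses (k_gt1 : (1 < k)%N) (eD : (num_arcs D + 2 = k * k.+1)%N).
Hypotheses (r_gt0 : 0 < r) (subx : subinvariant r x).
Hypothesis r_large : (k%:R - 2) * r + 2 * (k%:R - 1) <= r ^+ 2.
Implicit Types (u v m w : D) (N : {set D}).

(** Adding [x v] to both sides turns the sum over predecessors into one over the
    closed neighbourhood, which for an almost complete digraph is nearly the same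
    set for all [v]. *)
Lemma cpreds_ge v : (r + 1) * x v <= \sum_(u in v |: preds v) x u.
Proof.
by rewrite big_setU1 ?notin_preds //=; have := subinvP subx v; lra.
Qed.

Let K2 : 2 <= k%:R :> R. Proof. by rewrite (ler_nat _ 2). Qed.

Let eR : (num_arcs D)%:R = k%:R ^+ 2 + k%:R - 2 :> R.
Proof.
have := congr1 (fun n => n%:R : R) eD.
rewrite /= natrD natrM -[k.+1]addn1 natrD; lra.
Qed.

Let rK1 : k%:R - 1 < r.
Proof.
rewrite ltNge; apply/negP => rK.
by have := ler_wpM2l (ltW r_gt0) rK; move: r_large K2; rewrite expr2; lra.
Qed.

(* An in-degree above [k.+1] would give [r ^+ 2 <= k ^ 2 - 4], and then [r_large]
   makes [(k - r) * (4 - (k - r))] nonpositive. *)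
Let max_degree m : x m = 1 -> r < k%:R /\ (#|preds m| <= k.+1)%N.
Proof.
move=> xm; have le1 := max_le_indegree subx xm.
have le2 := max_sqr_le r_gt0 subx xm.
have eqe := num_arcs_cpreds m.
have : (#|preds m| + arcs_to (preds m))%:R <= (num_arcs D)%:R :> R.
  by rewrite ler_nat eqe leq_addr.
rewrite eR natrD => le3.
have rK : r < k%:R.
  by rewrite ltNge; apply/negP => Kr; have := ler_pM (ler0n _ _) (ler0n _ _) Kr Kr; lra.
split=> //; rewrite leqNgt; apply/negP => dm.
have : k%:R + 2 <= #|preds m|%:R :> R by rewrite -natrD ler_nat addn2.
have g1 : 0 < k%:R - r by lra.
have g2 : 0 < 4 - (k%:R - r) by move: rK1; lra.
have := mulr_gt0 g1 g2; move: r_large; lra.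
Qed.

(** [c] is left free between the weights inside and outside [T]: the two cases of
    the main argument use the two ends of that range. *)
Section Top.
Variables (T : {set D}) (c : R).
Hypotheses (cT : #|T| = k.+1) (geT : forall u, u \in T -> c <= x u).
Hypothesis (leT : forall u, u \notin T -> x u <= c).
Let s := \sum_(u in T) x u.

Lemma cpreds_le_top v : (r + 1) * x v <= s + (#|preds v|%:R - k%:R) * c.
Proof.
apply: le_trans (cpreds_ge v) (le_trans (sum_le_top _ geT leT) _).
by rewrite cT card_cpreds -!natr1 /s; lra.
Qed.

Lemma sum_top_le (B : {set D}) : (r + 1) * \sum_(v in B) x v <=
  #|B|%:R * s + ((arcs_to B)%:R - #|B|%:R * k%:R) * c.
Proof.
rewrite mulr_sumr (le_trans (ler_sum _ (fun v _ => cpreds_le_top v))) //.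
rewrite big_split /= -mulr_suml sumrB sumr_const -natr_arcs_to sumr_const.
by rewrite -(mulr_natl k%:R) -(mulr_natl s).
Qed.

(** A predecessor outside [T] has weight 0 and wastes a place worth [c] in the
    closed neighbourhood, which a tight inequality cannot afford. *)
Lemma preds_top v : 0 < c -> s + (#|preds v|%:R - k%:R) * c <= (r + 1) * x v ->
  (forall u, u \notin T -> x u = 0) -> v |: preds v \subset T.
Proof.
move=> c0 tight x0; apply/subsetP => u uv; apply: contraT => uT.
have := sum_le_top ((v |: preds v) :\ u) geT leT.
have := cpreds_ge v; rewrite (big_setD1 u uv) /= (x0 u uT) add0r.
have : #|(v |: preds v) :\ u| = #|preds v|.
  by have := cardsD1 u (v |: preds v); rewrite uv card_cpreds => -[].
move=> ->; rewrite cT -natr1 -/s; lra.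
Qed.
End Top.

(** [r_large] says that [r] is at least the larger root of
    [X ^+ 2 - (k - 2) * X - 2 * (k - 1)].  The case of small in-degree of the
    lightest vertex [w] of [T] contradicts it; in the other case the bounds on
    [x w] meet exactly at the root, so that all inequalities over [T] are tight.
    Then [T] contains all arcs and exactly two vertices of [T] have in-degree
    [k - 1]; both have the minimal weight, and tightness says that the vertex
    missing from the closed neighbourhood of one has minimal weight, hence is the
    other. *)
Lemma minus_K2_of_subinvariant :
  r ^+ 2 = (k%:R - 2) * r + 2 * (k%:R - 1) /\
  exists (T : {set D}) a b, [/\ #|T| = k.+1, a \in T, b \in T, a != b &
    clique_minus T [set (a, b); (b, a)]].
Proof.
have cD : (k.+1 <= #|D|)%N.
  by rewrite leqNgt; apply/negP => h; have := num_arcs_le D; nia.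
have [T [cT topT]] := top_subset x cD.
have [w0 w0T] : exists w, w \in T by apply/set0Pn; rewrite -cards_eq0 cT.
pose w := [arg min_(v < w0 in T) x v]%O.
have [wT wmin] : w \in T /\ forall v, v \in T -> x w <= x v.
  by rewrite /w; case: arg_minP.
have wout v : v \notin T -> x v <= x w by move=> vT; apply: topT.
have [_ [m xm] _] := subx; have [rK dm] := max_degree xm.
pose s := \sum_(u in T) x u.
have s_gt0 : 0 < s.
  have [mT|mT] := boolP (m \in T).
    rewrite /s (big_setD1 m mT) /= xm; apply: ltr_wpDr => //.
    by apply: sumr_ge0 => u _; apply: subinv_ge0 subx _.
  have := wout m mT; rewrite xm => xw.
  rewrite /s (big_setD1 w wT) /=; apply: ltr_wpDr; last by lra.
  by apply: sumr_ge0 => u _; apply: subinv_ge0 subx _.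
have cTw : #|T :\ w| = k by move: cT; rewrite (cardsD1 w) wT => -[].
have sTw : \sum_(u in T :\ w) x u = s - x w by rewrite /s (big_setD1 w wT) /= addrAC subrr add0r.
have aT := arcs_to_D1 wT; have aD := arcs_to_setC T.
have [dw|dw] := leqP k.-1 #|preds w|; last first.
  (* [c'] is the largest weight outside [T] and [d'] the in-degree of a vertex where
     it is attained; both are 0 if [T] is the whole vertex set. *)
  have [c' [d' [c0 cw cout rc [dd c1]]]] : exists c' (d' : nat), [/\ 0 <= c', c' <= x w,
      forall v, v \notin T -> x v <= c', r * c' <= d'%:R &
      (arcs_to T + d' <= num_arcs D)%N /\ c' <= 1].
    have [[w' w'T]|h] := pselect (exists w', w' \in ~: T).
      pose z := [arg max_(v > w' in ~: T) x v]%O.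
      have [zT zmax] : z \in ~: T /\ forall v, v \in ~: T -> x v <= x z.
        by rewrite /z; case: arg_maxP.
      exists (x z), #|preds z|; split.
      - exact: subinv_ge0 subx _.
      - by apply: wout; rewrite -in_setC.
      - by move=> v vT; apply: zmax; rewrite in_setC.
      - exact: subinv_le_indegree subx _.
      split; last exact: subinv_le1 subx _.
      by move: aD (arcs_to_D1 zT); clear; lia.
    exists 0, 0%N; split=> //; first exact: subinv_ge0 subx _.
      by move=> v vT; case: h; exists v; rewrite in_setC.
      by rewrite mulr0.
    by rewrite ler01 aD addn0 leq_addr.
  have c_le u : u \in T -> c' <= x u by move=> /wmin; apply: le_trans.
  have sum1 := sum_top_le cT c_le cout (T :\ w).
  have top1 := cpreds_le_top cT c_le cout m.
  rewrite cTw sTw -/s in sum1; rewrite -/s xm in top1.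
  have rw : r * x w <= #|preds w|%:R by apply: subinv_le_indegree subx _.
  have dwR : #|preds w|%:R <= k%:R - 2 :> R.
    have : (#|preds w| + 2)%:R <= k%:R :> R by rewrite ler_nat; move: dw; clear; lia.
    by rewrite natrD; lra.
  have dmR : #|preds m|%:R - k%:R <= 1 :> R.
    have : #|preds m|%:R <= k.+1%:R :> R by rewrite ler_nat.
    by rewrite -natr1; lra.
  have uE : (arcs_to (T :\ w))%:R + #|preds w|%:R + d'%:R <= k%:R ^+ 2 + k%:R - 2 :> R.
    by rewrite -eR -!natrD ler_nat; move: aT dd; clear; lia.
  (* [u] measures by how much the vertices of [T :\ w] exceed in-degree [k] on
     average; the excess is paid for by [w] and the vertex of weight [c']. *)
  set u : R := (arcs_to (T :\ w))%:R - k%:R * k%:R in sum1 *.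
  have {}uE : u + #|preds w|%:R + d'%:R <= k%:R - 2 by rewrite /u; lra.
  have s_ge : r + 1 - c' <= s.
    by have := ler_wpM2r c0 dmR; lra.
  have q_ge : (r + 1 - k%:R) * (r + 1 - c') <= (r + 1) * x w + u * c'.
    have q0 : 0 <= r + 1 - k%:R by move: rK1; lra.
    by have := ler_wpM2l q0 s_ge; lra.
  have step : (r + 1 - k%:R) * (r + 1) <= (r + 1) * x w + (u + 1) * c'.
    have : 0 <= k%:R - r by lra.
    by move=> h; have := mulr_ge0 h c0; lra.
  have r0 := ltW r_gt0.
  have r10 : 0 <= r + 1 by lra.
  have main : r * ((r + 1 - k%:R) * (r + 1)) <= (r + 1) * (k%:R - 2).
    have := ler_wpM2l r0 step; have := ler_wpM2l r10 rw.
    (* If [u + 1] is positive then [u >= 0], as [u] is an integer. *)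
    have [u1|u1] := lerP (u + 1) 0.
      have := ler_wpM2l r10 dwR.
      have := mulr_ge0 r0 c0; rewrite -oppr_ge0 in u1 => h.
      have := mulr_ge0 u1 h; lra.
    have u0 : 0 <= u.
      rewrite /u subr_ge0 -natrM ler_nat leqNgt; apply/negP => hu.
      have : (arcs_to (T :\ w) + 1)%:R <= (k * k)%:R :> R by rewrite ler_nat addn1.
      by rewrite natrD natrM; move: u1; rewrite /u; lra.
    have d0 : 0 <= d'%:R :> R by [].
    have dw0 : 0 <= #|preds w|%:R :> R by [].
    have ur : 0 <= r + 1 - (u + 1) by move: rK1; lra.
    have := ler_wpM2l (ltW u1) rc; have := mulr_ge0 ur d0.
    have := ler_wpM2l r10 uE; have := mulr_ge0 r10 u0; lra.
  have : (r + 1) * (r * (r + 1 - k%:R)) <= (r + 1) * (k%:R - 2) by lra.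
  rewrite ler_pM2l; last by lra.
  by move: r_large; lra.
pose c := x w; have c0 : 0 <= c by apply: subinv_ge0 subx _.
have top v := cpreds_le_top cT wmin wout v.
have sumT := sum_top_le cT wmin wout T.
have sumTw := sum_top_le cT wmin wout (T :\ w).
rewrite cT -natr1 -/s -/c in sumT; rewrite cTw sTw -/s -/c in sumTw.
have dwR : k%:R - 1 <= #|preds w|%:R :> R.
  have : k%:R <= (#|preds w| + 1)%:R :> R by rewrite ler_nat; move: dw; clear; lia.
  by rewrite natrD; lra.
have aTR : (arcs_to T)%:R = #|preds w|%:R + (arcs_to (T :\ w))%:R :> R.
  by rewrite aT natrD.
have aTle : (arcs_to T)%:R <= k%:R ^+ 2 + k%:R - 2 :> R.
  by rewrite -eR ler_nat aD leq_addr.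
have q_gt0 : 0 < r + 1 - k%:R by move: rK1; lra.
(* The vertices of [T] together receive at least two arcs less than [k] each would
   make, those of [T :\ w] at least one less. *)
have two_c : 2 * c <= (k%:R - r) * s.
  have : 0 <= k%:R ^+ 2 + k%:R - 2 - (arcs_to T)%:R :> R by lra.
  by move/mulr_ge0/(_ c0); lra.
have q_le : (r + 1 - k%:R) * s <= r * c.
  have : 0 <= k%:R ^+ 2 - 1 - (arcs_to (T :\ w))%:R :> R by lra.
  by move/mulr_ge0/(_ c0); lra.
have quad : 2 * (r + 1 - k%:R) <= r * (k%:R - r).
  rewrite -(ler_pM2r s_gt0).
  by have := ler_wpM2l (ltW r_gt0) two_c; lra.
have rE : r ^+ 2 = (k%:R - 2) * r + 2 * (k%:R - 1).
  by apply/le_anti; rewrite r_large andbT; lra.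
have c_gt0 : 0 < c.
  by have := mulr_gt0 q_gt0 s_gt0 => h; rewrite -(pmulr_rgt0 _ r_gt0); lra.
have two_cE : 2 * c = (k%:R - r) * s.
  apply/le_anti; rewrite two_c -(ler_pM2l r_gt0) /=.
  have : r * (k%:R - r) * s = 2 * (r + 1 - k%:R) * s by congr (_ * _); lra.
  by lra.
have qE : (r + 1 - k%:R) * s = r * c.
  apply/le_anti; rewrite q_le -(ler_pM2l (ltr0n _ 2)) /=.
  have : r * (k%:R - r) * s = 2 * (r + 1 - k%:R) * s by congr (_ * _); lra.
  have := congr1 ( *%R r) two_cE; lra.
have dw_eq : #|preds w| = k.-1.
  apply/eqP; rewrite eqn_leq dw andbT -ltnS prednK; last exact: ltnW.
  rewrite -(ltr_nat R) ltNge; apply/negP => dk.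
  have : 0 < k%:R ^+ 2 - 1 - (arcs_to (T :\ w))%:R :> R by lra.
  by move/mulr_gt0/(_ c_gt0); lra.
have aTwR : (arcs_to (T :\ w))%:R = k%:R ^+ 2 - 1 :> R.
  apply: (mulIf (lt0r_neq0 c_gt0)); have : 0 <= k%:R ^+ 2 - 1 - (arcs_to (T :\ w))%:R :> R by lra.
  by move/mulr_ge0/(_ c0); lra.
have aTw : (arcs_to (T :\ w) + 1 = k * k)%N.
  by apply/eqP; rewrite -(eqr_nat R) natrD aTwR natrM; apply/eqP; lra.
have out v : v \notin T -> preds v = set0.
  move=> vT; apply: (@arcs_to_eq0 _ (~: T)); last by rewrite in_setC.
  move: aD eD aT aTw dw_eq k_gt1; clear; nia.
have xout v : v \notin T -> x v = 0 by move/out; apply: (subinv_preds0 r_gt0 subx).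
have dwRE : #|preds w|%:R = k%:R - 1 :> R by rewrite dw_eq -subn1 natrB // ltnW.
have tight v : v \in T -> (r + 1) * x v = s + (#|preds v|%:R - k%:R) * c.
  move: v; apply: eq_of_sum_le => [v _|]; first exact: top.
  rewrite big_split /= -mulr_suml sumrB !sumr_const cT -natr_arcs_to aTR aTwR dwRE.
  by rewrite -mulr_sumr -/s -(mulr_natl s) -(mulr_natl k%:R) -natr1; lra.
have subT v : v \in T -> v |: preds v \subset T.
  move=> vT; apply: (preds_top cT wmin wout c_gt0) => //.
  by rewrite tight.
have dle v : v \in T -> (#|preds v| <= k)%N.
  by move=> /subT/subset_leq_card; rewrite card_cpreds cT.
have [z zT dz] : exists2 z, z \in T :\ w & (#|preds z| < k)%N.
  apply/exists_inP; apply: contraT => /exists_inPn h.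
  have : (#|T :\ w| * k <= arcs_to (T :\ w))%N.
    by rewrite -sum_nat_const; apply: leq_sum => u /h; rewrite -leqNgt.
  by rewrite cTw -aTw addn1 ltnn.
have arcs_le (B : {set D}) : B \subset T -> (arcs_to B <= #|B| * k)%N.
  move=> /subsetP BT; rewrite -sum_nat_const; apply: leq_sum => v /BT; exact: dle.
have TwT : T :\ w \subset T by apply: subsetDl.
have TzT : (T :\ w) :\ z \subset T by apply: subset_trans TwT; apply: subsetDl.
have cTz : #|(T :\ w) :\ z|.+1 = k by rewrite -cTw (cardsD1 z (T :\ w)) zT.
have az := arcs_to_D1 zT.
have dzE : #|preds z| = k.-1.
  move: (arcs_le _ TzT) dz az aTw cTz; clear; nia.
have dk v : v \in T -> v != w -> v != z -> #|preds v| = k.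
  move=> vT vw vz; have vB : v \in (T :\ w) :\ z by rewrite !in_setD1 vz vw.
  have := arcs_to_D1 vB; have := cardsD1 v ((T :\ w) :\ z); rewrite vB.
  have := arcs_le _ (subset_trans (subsetDl _ [set v]) TzT).
  move: (dle v vT) dzE az aTw cTz k_gt1; clear; nia.
have [zw zT'] : z != w /\ z \in T by move: zT; rewrite in_setD1 => /andP[].
have full v : v \in T -> v != w -> v != z -> v |: preds v = T.
  move=> vT vw vz; apply/eqP; rewrite eqEcard subT //= cT card_cpreds.
  by rewrite (dk v).
(* The vertex of [T] missing from the closed neighbourhood of a vertex of
   in-degree [k - 1] is one of minimal weight. *)
have partner v : v \in T -> #|preds v| = k.-1 ->
    exists b, [/\ b != v, (b == w) || (b == z) & v |: preds v = T :\ b].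
  move=> vT dv; have dvR : #|preds v|%:R = k%:R - 1 :> R by rewrite dv -dw_eq.
  have [b bE] : exists b, T :\: (v |: preds v) = [set b].
    apply/cards1P; rewrite cardsD (setIidPr (subT v vT)) cT card_cpreds dv.
    by move: k_gt1; clear; lia.
  have /setDP[bT bv] : b \in T :\: (v |: preds v) by rewrite bE set11.
  have NvE : v |: preds v = T :\ b.
    by rewrite -bE setDDr setDv set0U (setIidPr (subT v vT)).
  exists b; split=> //.
    by apply: contraNneq bv => ->; rewrite setU11.
  apply: contraT; rewrite negb_or => /andP[bw bz].
  have := tight b bT; rewrite (dk b) // subrr mul0r addr0 => xb.
  have := cpreds_ge v; rewrite NvE; have : s = x b + \sum_(u in T :\ b) x u.
    by rewrite /s (big_setD1 b bT).
  have := tight v vT; rewrite dvR.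
  have := tight w wT; rewrite dwRE -/c => xw xv sE xvle.
  have xbc : x b <= c by lra.
  have r10 : 0 <= r + 1 by rewrite addr_ge0 // ltW.
  have : c <= 0 by have := ler_wpM2l r10 xbc; lra.
  by rewrite leNgt c_gt0.
have [bw [bw1 bw2 Nw]] := partner w wT dw_eq.
have {bw1 bw2}bwE : bw = z by move: bw2; rewrite (negPf bw1) => /eqP.
have [bz [bz1 bz2 Nz]] := partner z zT' dzE.
have {bz1 bz2}bzE : bz = w by move: bz2; rewrite (negPf bz1) orbF => /eqP.
rewrite {bw}bwE in Nw; rewrite {bz}bzE in Nz.
split=> //; exists T, w, z; split=> //; first by rewrite eq_sym.
move=> u v; rewrite in_set2 !xpair_eqE.
have [vT|/out v0] := boolP (v \in T); last by rewrite -in_preds v0 in_set0 andbF.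
have adjE : adj u v = (u \in v |: preds v) && (u != v).
  rewrite in_setU1 in_preds; case: eqVneq => [->|_]; last by rewrite andbT.
  by rewrite adj_irrefl.
rewrite adjE; have [->|vw] := eqVneq v w.
  rewrite Nw in_setD1 (eq_sym w z) (negPf zw) andbF andbT /=.
  by case: (u == z); case: (u \in T); case: (u == w).
have [->|vz] := eqVneq v z.
  rewrite Nz in_setD1 andbF andbT orbF /=.
  by case: (u == z); case: (u \in T); case: (u == w).
by rewrite full // !andbF /= andbT.
Qed.

End MissingTwoArcs.

(** * Isomorphism up to isolated vertices and numbers of arcs *)

(** The embedding is taken from the model [H] into [D] because the models are
    digraphs on ['I_n], numbered by a set of vertices of [D]. *)
Lemma iso_of_embedding (D H : digraph) (g : H -> D) :
  injective g -> (forall i j, adj (g i) (g j) = adj i j) ->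
  (forall v : D, ~~ isolated v -> exists i, g i == v) -> iso_up_to_isolated D H.
Proof.
move=> g_inj gE g_onto.
have isoE i : isolated (g i) = isolated i.
  apply/forallP/forallP => h j; first by have := h (g j); rewrite !gE.
  have [/forallP/(_ (g i))|/g_onto[j' /eqP <-]] := boolP (isolated j).
    by rewrite andbC.
  by rewrite !gE.
have fP (v : delete_isolated D) : exists i, g i == val v by apply: g_onto; exact: (valP v).
have fH v : ~~ isolated (xchoose (fP v)).
  by rewrite -isoE (eqP (xchooseP (fP v))) (valP v).
pose f (v : delete_isolated D) : delete_isolated H := exist _ (xchoose (fP v)) (fH v).
have gf v : g (val (f v)) = val v by apply/eqP/(xchooseP (fP v)).
exists f; split; last by move=> v w; rewrite /= -[LHS]gE !gf.
have f'H (i : delete_isolated H) : ~~ isolated (g (val i)) by rewrite isoE (valP i).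
exists (fun i : delete_isolated H => exist _ (g (val i)) (f'H i)).
  by move=> v; apply: val_inj; rewrite /= gf.
by move=> i; apply/val_inj/g_inj; rewrite gf.
Qed.

Lemma iso_up_to_isolated_refl (D : digraph) : iso_up_to_isolated D D.
Proof. by exists id; split=> //; exists id. Qed.

Lemma isolated_arcless (D : digraph) (v : D) : num_arcs D = 0%N -> isolated v.
Proof.
rewrite num_arcsE => /eqP; rewrite sum_nat_eq0 => /forall_inP h.
have P0 (u w : D) : adj u w = false.
  have := h w isT; rewrite cards_eq0 => /eqP Pw.
  by rewrite -in_preds Pw in_set0.
by apply/forallP => w; rewrite !P0.
Qed.

Lemma iso_of_arcless (D H : digraph) :
  num_arcs D = 0%N -> num_arcs H = 0%N -> iso_up_to_isolated D H.
Proof.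
move=> D0 H0.
have nD (v : delete_isolated D) : False by have := valP v; rewrite isolated_arcless.
have nH (v : delete_isolated H) : False by have := valP v; rewrite isolated_arcless.
exists (fun v => False_rect _ (nD v)); split; last by move=> v; case: (nD v).
by exists (fun v => False_rect _ (nH v)) => v; [case: (nD v)|case: (nH v)].
Qed.

Lemma sum_preds_nonisolated (V : nmodType) (D : digraph) (F : D -> V) (v : D) :
  \sum_(u in preds v) F u = \sum_(u : delete_isolated D | adj (val u) v) F (val u).
Proof.
rewrite (reindex_omap (val : delete_isolated D -> D) insub) /=.
  apply: eq_bigl => u; rewrite valK eqxx andbT; exact: in_preds.
move=> u; rewrite in_preds => uv; rewrite insubT //=.
by apply/forallPn; exists v; rewrite uv.
Qed.

(** Extend the eigenvector by 0 at the isolated vertices of [D].  An eigenvector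
    for a nonzero [r] vanishes at the isolated vertices of [H], so nothing is lost
    in the transfer. *)
Lemma le_spectral_radius_of_iso (R : realType) (D H : digraph) (r : R) (x : H -> R) :
  iso_up_to_isolated D H -> 0 <= r -> (exists v, x v != 0) ->
  (forall v, \sum_(u in preds v) x u = r * x v) -> r <= spectral_radius R D.
Proof.
move=> [f [f_bij fE]]; rewrite le_eqVlt => /predU1P[<- _ _|r_gt0 [h0 xh0] xE].
  exact: spectral_radius_ge0.
pose y (v : D) : R := if insub v is Some v' then x (val (f v')) else 0.
have yE (v : delete_isolated D) : y (val v) = x (val (f v)) by rewrite /y valK.
have y0 v : isolated v -> y v = 0 by move=> v0; rewrite /y insubF // v0.
have iso_sum (E : digraph) (F : E -> R) v : isolated v -> \sum_(u in preds v) F u = 0.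
  move=> /forallP v0; rewrite big1 // => u; rewrite in_preds => uv.
  by have := v0 u; rewrite uv andbF.
apply: (le_spectral_radius (x := y) (ltW r_gt0)).
  have h0n : ~~ isolated h0.
    apply: contra xh0 => h0i; have /eqP := iso_sum H x h0 h0i.
    by rewrite xE mulf_eq0 gt_eqF.
  have [g fg gf] := f_bij.
  by exists (val (g (exist _ h0 h0n))); rewrite yE gf.
move=> v; have [v0|v_n] := boolP (isolated v); first by rewrite y0 // mulr0 iso_sum.
pose v' : delete_isolated D := exist _ v v_n.
rewrite -[v]/(val v') yE -xE !sum_preds_nonisolated [RHS](reindex f) /=; last first.
  by case: f_bij => g fg gf; exists g => i _; [apply: fg|apply: gf].
apply: eq_big => [u|u _]; last exact: yE.
exact/esym/fE.
Qed.

Lemma num_arcs_complete n : num_arcs (complete_digraph n) = (n * n.-1)%N.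
Proof.
rewrite num_arcsE (eq_bigr (fun=> n.-1)) ?sum_nat_const ?card_ord // => v _.
have -> : preds v = ~: [set v].
  by apply/setP => u; rewrite in_preds in_setC in_set1.
by have := cardsC [set v]; rewrite cards1 card_ord; lia.
Qed.

Lemma num_arcs_delete (D : digraph) (S : {set D * D}) :
  (forall p, p \in S -> adj p.1 p.2) -> (num_arcs (delete_arcs S) + #|S| = num_arcs D)%N.
Proof.
move=> SD; rewrite /num_arcs -(cardsID S [set p : D * D | adj p.1 p.2]) addnC.
congr (_ + _)%N; apply: eq_card => p; rewrite !inE.
  by case: (boolP (p \in S)) => [/SD ->|]; rewrite ?andbF.
by rewrite andbC /= -surjective_pairing.
Qed.

Lemma num_arcs_complete_minus_K2 n (u v : 'I_n) : u != v ->
  (num_arcs (complete_minus_K2 u v) + 2 = n * n.-1)%N.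
Proof.
move=> uv; rewrite -num_arcs_complete.
rewrite -(@num_arcs_delete (complete_digraph n) [set (u, v); (v, u)]) ?cards2 //.
  by rewrite xpair_eqE negb_and uv.
by move=> p /set2P[] -> //=; rewrite eq_sym.
Qed.

Lemma num_arcs_complete_minus_arc n (u v : 'I_n) : u != v ->
  (num_arcs (complete_minus_arc u v) + 1 = n * n.-1)%N.
Proof.
move=> uv; rewrite -num_arcs_complete.
rewrite -(@num_arcs_delete (complete_digraph n) [set (u, v)]) ?cards1 //.
by move=> p /set1P ->.
Qed.

Lemma preds_complete_minus n (M : {set 'I_n * 'I_n}) (v : 'I_n) :
  @preds (@delete_arcs (complete_digraph n) M) v = [set u | (u != v) && ((u, v) \notin M)].
Proof. by apply/setP => u; rewrite !inE. Qed.

Lemma num_arcs_complete_plus_arc k (H : digraph) :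
  is_complete_plus_arc k H -> num_arcs H = (k * k.-1 + 1)%N.
Proof.
move=> [S [u [v [cS uv uvS adjE]]]]; rewrite num_arcsE.
have cP w : #|preds w| = ((if w \in S then k.-1 else 0) + (w == v))%N.
  have -> : preds w = [set y | [&& y \in S, w \in S & y != w]] :|: [set y | (y, w) == (u, v)].
    by apply/setP => y; rewrite in_preds adjE !inE.
  rewrite cardsU (_ : _ :&: _ = set0) ?cards0 ?subn0; last first.
    apply/setP => y; rewrite !inE; apply/negP => /andP[/and3P[yS wS _]].
    by rewrite xpair_eqE => /andP[/eqP yu /eqP wv]; rewrite -yu -wv yS wS in uvS.
  congr (_ + _)%N; last first.
    have [->|wv] := eqVneq w v.
      by rewrite (_ : [set _ | _] = [set u]) ?cards1 //; apply/setP => y;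
        rewrite !inE xpair_eqE eqxx andbT.
    by rewrite (_ : [set _ | _] = set0) ?cards0 //; apply/setP => y;
        rewrite !inE xpair_eqE (negPf wv) andbF.
  case: ifP => wS.
    rewrite (_ : [set _ | _] = S :\ w).
      by have := cardsD1 w S; rewrite wS cS; lia.
    by apply/setP => y; rewrite !inE andbC.
  by rewrite (_ : [set _ | _] = set0) ?cards0 //; apply/setP => y; rewrite !inE andbF.
rewrite (eq_bigr _ (fun w _ => cP w)) big_split /= -big_mkcond /= sum_nat_const cS.
by congr (_ + _)%N; rewrite (bigD1 v) //= eqxx big1 // => w /negPf ->.
Qed.

(** * Recognizing the extremal digraphs, and their eigenvectors *)

(** One numbering of [T] serves for all models that differ from the complete
    digraph by prescribed missing arcs. *)
Lemma clique_numbering (D : digraph) n (T : {set D}) (M : {set D * D}) :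
  #|T| = n -> clique_minus T M ->
  exists g : 'I_n -> D, [/\ injective g, forall t, t \in T -> exists i, g i = t &
    forall (H : rel 'I_n) (irrH : irreflexive H),
      (forall i j, H i j = (i != j) && ((g i, g j) \notin M)) ->
      iso_up_to_isolated D (Digraph irrH)].
Proof.
move=> cT adjE; pose g (i : 'I_n) : D := enum_val (cast_ord (esym cT) i).
have gT i : g i \in T by apply: enum_valP.
have g_inj : injective g by move=> i j /enum_val_inj/cast_ord_inj.
have g_onto t : t \in T -> exists i, g i = t.
  move=> tT; exists (cast_ord cT (enum_rank_in tT t)).
  by rewrite /g cast_ordK enum_rankK_in.
exists g; split=> // H irrH HE.
apply: (@iso_of_embedding D (Digraph irrH) g) => //=.
  by move=> i j; rewrite adjE !gT HE /= (inj_eq g_inj).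
move=> v; have [/g_onto[i <-] _|vT] := boolP (v \in T); first by exists i.
by case/negP; apply/forallP => w; rewrite !adjE (negPf vT) /= !andbF.
Qed.

Lemma iso_complete_of_clique (D : digraph) n (T : {set D}) :
  #|T| = n -> (forall u v, adj u v = [&& u \in T, v \in T & u != v]) ->
  iso_up_to_isolated D (complete_digraph n).
Proof.
move=> cT adjE; have adjE' : clique_minus T set0.
  by move=> u v; rewrite adjE inE andbT.
have [g [_ _ ]] := clique_numbering cT adjE'; apply=> i j.
by rewrite inE andbT.
Qed.

Lemma iso_complete_minus_arc_of_clique (D : digraph) n (T : {set D}) b j :
  #|T| = n -> b \in T -> j \in T -> b != j -> clique_minus T [set (b, j)] ->
  exists u v : 'I_n, u != v /\ iso_up_to_isolated D (complete_minus_arc u v).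
Proof.
move=> cT bT jT bj adjE; have [g [g_inj g_onto gE]] := clique_numbering cT adjE.
have [u gu] := g_onto b bT; have [v gv] := g_onto j jT.
exists u, v; split; first by apply: contraNneq bj => uv; rewrite -gu -gv uv.
by apply: gE => i i'; rewrite !in_set1 !xpair_eqE -gu -gv !(inj_eq g_inj).
Qed.

Lemma iso_complete_minus_K2_of_clique (D : digraph) n (T : {set D}) a b :
  #|T| = n -> a \in T -> b \in T -> a != b -> clique_minus T [set (a, b); (b, a)] ->
  exists u v : 'I_n, u != v /\ iso_up_to_isolated D (complete_minus_K2 u v).
Proof.
move=> cT aT bT ab adjE; have [g [g_inj g_onto gE]] := clique_numbering cT adjE.
have [u gu] := g_onto a aT; have [v gv] := g_onto b bT.
exists u, v; split; first by apply: contraNneq ab => uv; rewrite -gu -gv uv.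
by apply: gE => i i'; rewrite !in_set2 !xpair_eqE -gu -gv !(inj_eq g_inj).
Qed.

Lemma iso_oriented_triangle (D : digraph) (a b c : D) :
  preds a = [set b] -> preds b = [set c] -> preds c = [set a] -> uniq [:: a; b; c] ->
  (forall v, v \notin [:: a; b; c] -> preds v = set0) ->
  iso_up_to_isolated D oriented_triangle.
Proof.
move=> Pa Pb Pc; rewrite /= !inE negb_or andbT => /andP[/andP[ab ac] bc] out.
(* The arcs are [c -> b], [b -> a] and [a -> c], so the cyclic order is [a], [c],
   [b]. *)
pose g (i : 'I_3) := nth a [:: a; c; b] i.
have adjE u v : adj u v = (u \in preds v) by rewrite in_preds.
have [ba ca cb] : [/\ b != a, c != a & c != b] by split; rewrite eq_sym.
have ne := (negPf ab, negPf ac, negPf bc, negPf ba, negPf ca, negPf cb).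
apply: (@iso_of_embedding D oriented_triangle g).
- by move=> [[|[|[|//]]] ?] [[|[|[|//]]] ?] /eqP; rewrite /g /= ?ne // => _; apply: val_inj.
- by move=> [[|[|[|//]]] ?] [[|[|[|//]]] ?]; rewrite /g /= adjE ?Pa ?Pb ?Pc inE ?eqxx ?ne.
move=> v; have [|/out v0] := boolP (v \in [:: a; b; c]).
  rewrite !inE => /or3P[]/eqP-> _.
  - by exists (inord 0); rewrite /g inordK.
  - by exists (inord 2); rewrite /g inordK.
  - by exists (inord 1); rewrite /g inordK.
have out_arc w : adj v w = false.
  apply/negP; rewrite adjE; have [wabc|/out ->] := boolP (w \in [:: a; b; c]); last by rewrite inE.
  have /or3P[] : [|| w == a, w == b | w == c] by rewrite !inE in wabc.
  + by move=> /eqP->; rewrite Pa => /set1P vE; have := set11 c; rewrite -Pb -vE v0 inE.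
  + by move=> /eqP->; rewrite Pb => /set1P vE; have := set11 a; rewrite -Pc -vE v0 inE.
  + by move=> /eqP->; rewrite Pc => /set1P vE; have := set11 b; rewrite -Pa -vE v0 inE.
by case/negP; apply/forallP => w; rewrite out_arc adjE v0 inE.
Qed.

Section Eigenvectors.
Variable R : realType.

Lemma le_spectral_radius_complete (D : digraph) n :
  iso_up_to_isolated D (complete_digraph n.+1) -> n%:R <= spectral_radius R D.
Proof.
move=> iso; apply: (le_spectral_radius_of_iso (x := fun=> 1) iso (ler0n R n)).
  by exists (ord0 : complete_digraph n.+1); apply: oner_neq0.
move=> v; rewrite mulr1 sum1_const.
have -> : preds v = ~: [set v].
  by apply/setP => u; rewrite in_preds in_setC in_set1.
by have := cardsC [set v]; rewrite cards1 card_ord add1n => -[->].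
Qed.

Lemma le_spectral_radius_triangle (D : digraph) :
  iso_up_to_isolated D oriented_triangle -> 1 <= spectral_radius R D.
Proof.
move=> iso; apply: (le_spectral_radius_of_iso (x := fun=> 1) iso ler01).
  by exists (ord0 : oriented_triangle); apply: oner_neq0.
move=> v; rewrite mulr1 sum1_const.
suff [u ->] : exists u, preds v = [set u] by rewrite cards1.
exists (inord ((v + 2) %% 3)); apply/setP => u.
rewrite in_preds in_set1 -val_eqE /= inordK ?ltn_mod //.
by case: v u => [[|[|[|//]]] ?] [[|[|[|//]]] ?].
Qed.

(** The eigenvector is 1 on the clique [S]; if the additional arc leaves [S], its
    head inherits weight [1 / n] from its only predecessor. *)
Lemma le_spectral_radius_plus_arc (D H : digraph) n : (0 < n)%N ->
  is_complete_plus_arc n.+1 H -> iso_up_to_isolated D H -> n%:R <= spectral_radius R D.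
Proof.
move=> n_gt0 [S [u [v [cS uv uvS adjE]]]] iso.
have n0 : n%:R != 0 :> R by rewrite pnatr_eq0 -lt0n.
pose x (w : H) : R := (w \in S)%:R +
  ((w == v) && (u \in S))%:R / n%:R.
have sumS (w : H) : w \in S -> \sum_(y in S :\ w) (1 : R) = n%:R.
  by move=> wS; rewrite sum1_const; move: cS; rewrite (cardsD1 w) wS add1n => -[->].
have xS w : w \in S -> x w = 1.
  move=> wS; rewrite /x wS; case: eqP => [wv|_] /=; rewrite ?mul0r ?addr0 //.
  by case uS: (u \in S); rewrite ?mul0r ?addr0 //; rewrite uS -wv wS in uvS.
apply: (le_spectral_radius_of_iso (x := x) iso (ler0n R n)).
  have /set0Pn[w wS] : S != set0 by rewrite -cards_eq0 cS.
  by exists w; rewrite xS // oner_neq0.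
have PS w : \sum_(y in preds w) x y =
    (if w \in S then n%:R else 0) + (if w == v then x u else 0).
  pose A : {set H} := if w \in S then S :\ w else set0.
  pose B : {set H} := if w == v then [set u] else set0.
  rewrite (eq_bigl (fun y => y \in [predU A & B])); last first.
    move=> y; rewrite in_preds adjE xpair_eqE inE /= /A /B.
    by case: (w \in S); case: (w == v); rewrite !inE ?andbF ?andbT ?orbF //= andbC.
  rewrite bigU /A /B /=; last first.
    rewrite disjoints_subset; apply/subsetP => y; case: ifP; rewrite ?inE // => wS.
    move=> /andP[_ yS]; case: eqP => [wv|_]; rewrite !inE //.
    by apply: contraNneq uvS => <-; rewrite yS -wv.
  congr (_ + _); last by case: ifP; rewrite ?big_set1 ?big_set0.
  case: ifP => wS; rewrite ?big_set0 // -(sumS w wS); apply: eq_bigr => y.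
  by rewrite in_setD1 => /andP[_ /xS].
move=> w; rewrite PS.
have [wS|wS] := boolP (w \in S).
  rewrite (xS w wS) mulr1; case: eqP => [wv|_]; rewrite ?addr0 //.
  rewrite /x (negPf (_ : u \notin S)) ?andbF ?mul0r ?addr0 //.
  by apply: contra uvS => ->; rewrite -wv.
rewrite /x (negPf wS) !add0r.
case: eqP => [wv|_] /=; rewrite ?mul0r ?mulr0 // (negPf uv) /= mul0r addr0.
by rewrite mulrC divfK.
Qed.

(** The head [v] of the missing arc has weight [r - k + 1] and all others weight 1;
    the equation at [v] is the quadratic equation for [r]. *)
Lemma le_spectral_radius_minus_arc (D : digraph) k (u v : 'I_k.+1) (r : R) :
  u != v -> 0 < r -> r ^+ 2 = (k%:R - 1) * (r + 1) ->
  iso_up_to_isolated D (complete_minus_arc u v) -> r <= spectral_radius R D.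
Proof.
move=> uv r_gt0 rE iso.
pose x (w : 'I_k.+1) : R := if w == v then r - k%:R + 1 else 1.
have xu : x u = 1 by rewrite /x (negPf uv).
have xv : x v = r - k%:R + 1 by rewrite /x eqxx.
have tot : \sum_w x w = r + 1.
  rewrite (bigD1 v) //= xv (eq_bigr (fun=> 1)); last by move=> w; rewrite /x => /negPf ->.
  rewrite sumr_const.
  have -> : #|[pred w | w != v]| = k by have := cardC1 v; rewrite card_ord.
  by lra.
apply: (le_spectral_radius_of_iso (x := x : complete_minus_arc u v -> R) iso (ltW r_gt0)).
  by exists u; rewrite xu oner_neq0.
move=> w; rewrite (preds_complete_minus _ w).
have [->|wv] := eqVneq w v.
  rewrite (eq_bigl (fun y => (y != v) && (y != u))); last first.
    by move=> y; rewrite !inE xpair_eqE eqxx andbT.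
  move: tot; rewrite (bigD1 v) //= (bigD1 u) //= xu xv; lra.
rewrite (eq_bigl (fun y => y != w)); last first.
  by move=> y; rewrite !inE xpair_eqE (negPf wv) andbF andbT.
by move: tot; rewrite (bigD1 w) //= /x (negPf wv); lra.
Qed.

(** Weight [k - 1] at the two nonadjacent vertices and [r] elsewhere; the equation
    at the other vertices is the quadratic equation for [r]. *)
Lemma le_spectral_radius_minus_K2 (D : digraph) k (u v : 'I_k.+1) (r : R) :
  u != v -> 0 < r -> r ^+ 2 = (k%:R - 2) * r + 2 * (k%:R - 1) ->
  iso_up_to_isolated D (complete_minus_K2 u v) -> r <= spectral_radius R D.
Proof.
move=> uv r_gt0 rE iso.
pose x (w : 'I_k.+1) : R := if (w == u) || (w == v) then k%:R - 1 else r.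
have xu : x u = k%:R - 1 by rewrite /x eqxx.
have xv : x v = k%:R - 1 by rewrite /x eqxx orbT.
have tot' : \sum_(w | (w != u) && (w != v)) x w = (k%:R - 1) * r.
  rewrite (eq_bigr (fun=> r)); last by move=> w /andP[/negPf wu /negPf wv]; rewrite /x wu wv.
  rewrite sumr_const -(mulr_natl r); congr (_ * _).
  have := cardsC [set u; v]; rewrite cards2 uv card_ord => h.
  rewrite (eq_card (B := mem (~: [set u; v]))); last first.
    by move=> w; rewrite !inE negb_or.
  by have := congr1 (fun n => n%:R : R) h; rewrite /= natrD -natr1; lra.
have tot : \sum_w x w = (k%:R - 1) * r + 2 * (k%:R - 1).
  by rewrite (bigD1 u) //= (bigD1 v) ?(eq_sym v) //= tot' xu xv; lra.
have xu0 : x u != 0.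
  rewrite xu; apply/eqP => k1.
  suff : r * (r + 1) = 0 by apply/eqP; rewrite mulf_neq0 ?gt_eqF ?addr_gt0.
  have -> : r * (r + 1) = r ^+ 2 + r by lra.
  have k1' : k%:R = 1 :> R by lra.
  by rewrite rE k1'; lra.
apply: (le_spectral_radius_of_iso (x := x : complete_minus_K2 u v -> R) iso (ltW r_gt0)).
  by exists u.
move=> w; rewrite (preds_complete_minus _ w).
have [->|wu] := eqVneq w u.
  rewrite (eq_bigl (fun y => (y != u) && (y != v))); last first.
    by move=> y; rewrite !inE !xpair_eqE eqxx (negPf uv) andbF andbT /=.
  by rewrite tot' xu mulrC.
have [->|wv] := eqVneq w v.
  rewrite (eq_bigl (fun y => (y != u) && (y != v))); last first.
    move=> y; rewrite !inE !xpair_eqE eqxx (eq_sym v) (negPf uv) andbF andbT orbF.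
    by rewrite andbC.
  by rewrite tot' xv mulrC.
rewrite (eq_bigl (fun y => y != w)); last first.
  by move=> y; rewrite !inE !xpair_eqE (negPf wu) (negPf wv) !andbF andbT.
have xw : x w = r by rewrite /x (negPf wu) (negPf wv).
by move: tot; rewrite (bigD1 w) //= xw; lra.
Qed.

End Eigenvectors.

(** * The extremal problem *)

(** [c >= 0] makes the second root of [X ^+ 2 - b * X - c] nonpositive, so that
    beyond [q] the polynomial is nonnegative and vanishes only at [q]. *)
Lemma quadratic_root (R : rcfType) (b c : R) : 0 <= c ->
  let q := (b + Num.sqrt (b ^+ 2 + 4 * c)) / 2 in
  [/\ 0 <= q, q ^+ 2 = b * q + c,
      forall r, q <= r -> b * r + c <= r ^+ 2 &
      forall r, q <= r -> r ^+ 2 = b * r + c -> r = q].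
Proof.
move=> c0; set d := Num.sqrt _; move=> q.
have d0 : 0 <= d by apply: sqrtr_ge0.
have dE : d ^+ 2 = b ^+ 2 + 4 * c by rewrite sqr_sqrtr // addr_ge0 ?sqr_ge0 ?mulr_ge0.
have db : `|b| <= d by rewrite -sqrtr_sqr ler_wsqrtr // lerDl mulr_ge0.
have /andP[bd1 bd2] : (- d <= b) && (b <= d) by rewrite -ler_norml.
have q0 : 0 <= q by rewrite /q; lra.
have root r : r ^+ 2 - (b * r + c) = (r - q) * (r - (b - d) / 2).
  by rewrite /q; move: dE; lra.
have other : (b - d) / 2 <= 0 by lra.
split=> //.
- by apply/eqP; rewrite -subr_eq0 root subrr mul0r.
- by move=> r qr; rewrite -subr_ge0 root mulr_ge0 ?subr_ge0 // (le_trans other) ?(le_trans q0).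
move=> r qr /eqP; rewrite -subr_eq0 root mulf_eq0 !subr_eq0 => /orP[/eqP//|/eqP rE].
by lra.
Qed.

Section Extremal.
Variable R : realType.

(** [P] describes the extremal digraphs.  It suffices to bound their radius from
    below and to show that only they reach [r]: a digraph with a larger radius
    would also reach [r], and then its radius would be [r]. *)
Lemma max_spectral_radius_of (e : nat) (r : R) (P : digraph -> Prop) :
  (exists D, num_arcs D = e /\ P D) ->
  (forall D, num_arcs D = e -> P D -> r <= spectral_radius R D) ->
  (forall D, num_arcs D = e -> r <= spectral_radius R D ->
     spectral_radius R D = r /\ P D) ->
  max_spectral_radius e r /\
  forall D, num_arcs D = e -> (spectral_radius R D = r <-> P D).
Proof.
move=> [D0 [eD0 PD0]] low up; have radE D : num_arcs D = e -> P D -> spectral_radius R D = r.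
  by move=> eD PD; have [] := up D eD (low D eD PD).
split; last first.
  move=> D eD; split=> [rD|]; last exact: radE.
  by have := up D eD; rewrite rD lexx => /(_ isT)[].
split; first by exists D0; split=> //; apply: radE.
move=> D eD; rewrite leNgt; apply/negP => rD.
by have [rE _] := up D eD (ltW rD); rewrite rE ltxx in rD.
Qed.

(** A radius above [n] would force in-degree at least [n.+1] at a vertex [m] of
    maximal weight and more than [n ^ 2] arcs into [preds m]. *)
Lemma spectral_radius_le_of_num_arcs (D : digraph) n :
  (num_arcs D <= n.+1 * n + 1)%N -> spectral_radius R D <= n%:R.
Proof.
move=> eD; rewrite leNgt; apply/negP => rn.
have r0 : 0 < spectral_radius R D by apply: le_lt_trans rn.
have [x subx] := spectral_radius_subinvariant r0; have [_ [m xm] _] := subx.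
have dm := lt_le_trans rn (max_le_indegree subx xm); rewrite ltr_nat in dm.
have := lt_le_trans (ltr_pM (ler0n _ _) (ler0n _ _) rn rn) (max_sqr_le r0 subx xm).
by rewrite -natrM ltr_nat; have := num_arcs_cpreds m; nia.
Qed.

Lemma extremal_complete n :
  max_spectral_radius (n.+1 * n) (n%:R : R) /\
  forall D, num_arcs D = (n.+1 * n)%N ->
    (spectral_radius R D = n%:R <-> iso_up_to_isolated D (complete_digraph n.+1)).
Proof.
apply: max_spectral_radius_of.
- exists (complete_digraph n.+1); rewrite num_arcs_complete.
  by split=> //; apply: iso_up_to_isolated_refl.
- by move=> D _; apply: le_spectral_radius_complete.
move=> D eD nr; have rE : spectral_radius R D = n%:R.
  by apply/le_anti; rewrite nr andbT; apply: spectral_radius_le_of_num_arcs; rewrite eD leq_addr.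
split=> //; case: (posnP n) => [n0|n_gt0].
  by apply: iso_of_arcless; rewrite ?num_arcs_complete ?eD n0.
have [|x] := @spectral_radius_subinvariant R D; first by rewrite rE ltr0n.
rewrite rE => subx; have [T [cT adjE]] := complete_of_subinvariant n_gt0 eD subx.
exact: iso_complete_of_clique cT adjE.
Qed.

Fact plus_arc_irrefl n : irreflexive (fun x y : 'I_n.+2 =>
  [&& x != ord_max, y != ord_max & x != y] || ((x, y) == (ord0, ord_max))).
Proof. by move=> x; rewrite eqxx !andbF xpair_eqE; case: eqP => // ->. Qed.

Lemma ex_complete_plus_arc n : exists H, is_complete_plus_arc n.+1 H.
Proof.
exists (Digraph (@plus_arc_irrefl n)), [set~ ord_max], ord0, ord_max; split=> //.
- by rewrite cardsC1 card_ord.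
- by rewrite !inE eqxx andbF.
by move=> x y; rewrite !inE.
Qed.

Lemma extremal_complete_plus_arc n : (0 < n)%N ->
  max_spectral_radius (n.+1 * n + 1) (n%:R : R) /\
  forall D, num_arcs D = (n.+1 * n + 1)%N ->
    (spectral_radius R D = n%:R <->
     (n = 1%N /\ iso_up_to_isolated D oriented_triangle) \/
     exists H, is_complete_plus_arc n.+1 H /\ iso_up_to_isolated D H).
Proof.
move=> n_gt0; apply: max_spectral_radius_of.
- have [H HP] := ex_complete_plus_arc n; exists H.
  split; first exact: num_arcs_complete_plus_arc HP.
  by right; exists H; split=> //; apply: iso_up_to_isolated_refl.
- move=> D _ [[-> tri]|[H [HP isoH]]]; first exact: le_spectral_radius_triangle.
  exact: le_spectral_radius_plus_arc n_gt0 HP isoH.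
move=> D eD nr; have rE : spectral_radius R D = n%:R.
  by apply/le_anti; rewrite nr andbT; apply: spectral_radius_le_of_num_arcs; rewrite eD.
split=> //; have [|x] := @spectral_radius_subinvariant R D; first by rewrite rE ltr0n.
rewrite rE => /(plus_arc_of_subinvariant n_gt0 eD).
case=> [DP|[n1 [a [b [c [Pa Pb Pc abc out]]]]]].
  by right; exists D; split=> //; apply: iso_up_to_isolated_refl.
by left; split=> //; apply: iso_oriented_triangle Pa Pb Pc abc out.
Qed.

Lemma max_spectral_radius_one_arc : max_spectral_radius 1 (0 : R).
Proof.
have le0 D : num_arcs D = 1%N -> spectral_radius R D <= 0.
  by move=> eD; apply: (@spectral_radius_le_of_num_arcs D 0); rewrite eD.
split=> //; have [H HP] := ex_complete_plus_arc 0; exists H.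
have eH := num_arcs_complete_plus_arc HP; split=> //.
by apply/le_anti; rewrite le0 // spectral_radius_ge0.
Qed.

Lemma extremal_complete_minus_K2 k e : (1 < k)%N -> (e + 2 = k * k.+1)%N ->
  let r : R := (k%:R - 2 + Num.sqrt ((k%:R - 2) ^+ 2 + 8 * (k%:R - 1))) / 2 in
  max_spectral_radius e r /\
  forall D, num_arcs D = e ->
    (spectral_radius R D = r <->
     exists u v : 'I_k.+1, u != v /\ iso_up_to_isolated D (complete_minus_K2 u v)).
Proof.
move=> k_gt1 eE r; have k1 : 1 <= k%:R - 1 :> R.
  by have : 2 <= k%:R :> R; [rewrite (ler_nat _ 2)|lra].
have [|] := @quadratic_root R (k%:R - 2) (2 * (k%:R - 1)); first by lra.
rewrite (_ : 4 * (2 * _) = 8 * (k%:R - 1)); last by lra.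
rewrite -/r => r0 rE r_le r_uniq.
have r_gt0 : 0 < r.
  rewrite lt_neqAle r0 andbT; apply/eqP => r00; move: rE; rewrite -r00; lra.
apply: max_spectral_radius_of.
- exists (@complete_minus_K2 k.+1 ord0 ord_max); split.
    by have := @num_arcs_complete_minus_K2 k.+1 ord0 ord_max; rewrite -val_eqE /=; lia.
  exists ord0, ord_max; split; last exact: iso_up_to_isolated_refl.
  by rewrite -val_eqE /=; lia.
- by move=> D _ [u [v [uv]]]; apply: le_spectral_radius_minus_K2.
move=> D eD rD; have rho_gt0 := lt_le_trans r_gt0 rD.
have [x subx] := spectral_radius_subinvariant rho_gt0.
have eD2 : (num_arcs D + 2 = k * k.+1)%N by rewrite eD.
have [rhoE [T [a [b [cT aT bT ab adjE]]]]] :=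
  minus_K2_of_subinvariant k_gt1 eD2 rho_gt0 subx (r_le _ rD).
split; first exact: r_uniq.
exact: iso_complete_minus_K2_of_clique adjE.
Qed.

Lemma extremal_complete_minus_arc k e : (1 < k)%N -> (e + 1 = k * k.+1)%N ->
  let r : R := (k%:R - 1 + Num.sqrt ((k%:R - 1) ^+ 2 + 4 * (k%:R - 1))) / 2 in
  max_spectral_radius e r /\
  forall D, num_arcs D = e ->
    (spectral_radius R D = r <->
     exists u v : 'I_k.+1, u != v /\ iso_up_to_isolated D (complete_minus_arc u v)).
Proof.
move=> k_gt1 eE r; have k1 : 1 <= k%:R - 1 :> R.
  by have : 2 <= k%:R :> R; [rewrite (ler_nat _ 2)|lra].
have [|] := @quadratic_root R (k%:R - 1) (k%:R - 1); first by lra.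
rewrite -/r => r0 rE r_le r_uniq.
have r_gt0 : 0 < r.
  rewrite lt_neqAle r0 andbT; apply/eqP => r00; move: rE; rewrite -r00; lra.
have mulE (y : R) : (k%:R - 1) * y + (k%:R - 1) = (k%:R - 1) * (y + 1) by lra.
rewrite mulE in rE.
apply: max_spectral_radius_of.
- exists (@complete_minus_arc k.+1 ord0 ord_max); split.
    by have := @num_arcs_complete_minus_arc k.+1 ord0 ord_max; rewrite -val_eqE /=; lia.
  exists ord0, ord_max; split; last exact: iso_up_to_isolated_refl.
  by rewrite -val_eqE /=; lia.
- by move=> D _ [u [v [uv]]]; apply: le_spectral_radius_minus_arc.
move=> D eD rD; have rho_gt0 := lt_le_trans r_gt0 rD.
have [x subx] := spectral_radius_subinvariant rho_gt0.
have eD2 : (num_arcs D + 1 = k * k.+1)%N by rewrite eD.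
have := r_le _ rD; rewrite mulE => r_large.
have [rhoE [T [b [j [cT bT jT bj adjE]]]]] :=
  minus_arc_of_subinvariant k_gt1 eD2 rho_gt0 subx r_large.
split; first by apply: r_uniq => //; rewrite mulE.
exact: iso_complete_minus_arc_of_clique adjE.
Qed.

Lemma iso_complete_minus_arc_of_one_arc (D : digraph) : num_arcs D = 1%N ->
  exists u v : 'I_2, u != v /\ iso_up_to_isolated D (complete_minus_arc u v).
Proof.
move=> eD; have /eqP/cards1P[[p q] pqE] : num_arcs D = 1%N by [].
have adjE u v : adj u v = ((u, v) == (p, q)).
  by have := in_set1 (u, v) (p, q); rewrite -pqE inE.
have pq : p != q by apply/eqP => pq; have := adjE p q; rewrite eqxx pq adj_irrefl.
have qp : q != p by rewrite eq_sym.
apply: (@iso_complete_minus_arc_of_clique D 2 [set p; q] q p);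
  rewrite ?cards2 ?set21 ?set22 ?pq ?qp // => u v.
rewrite adjE !in_set2 in_set1 !xpair_eqE.
case: (eqVneq u p) => [->|up]; first rewrite (negPf pq) !andbT /=.
  by case: (eqVneq v q) => [->|vq]; rewrite ?(negPf qp) ?pq //= orbF; case: eqVneq.
case: (eqVneq u q) => [->|uq] //=.
have [->|vp] := eqVneq v p; first by rewrite !andbF.
by case: (eqVneq v q).
Qed.

End Extremal.

Theorem theorem1p6 (R : realType) (k e : nat) (hk : (0 < k)%N) :
  [/\ (* part 1 *)
      e = (k * (k - 1))%N ->
      let rho_e : R := k%:R - 1 in
      max_spectral_radius e rho_e /\
      (forall D : digraph, num_arcs D = e ->
        (spectral_radius R D = rho_e <->
         iso_up_to_isolated D (complete_digraph k))),
      (* part 2 *)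
      e = (k * (k - 1) + 1)%N ->
      let rho_e : R := k%:R - 1 in
      [/\ max_spectral_radius e rho_e,
          ((2 < k)%N -> forall D : digraph, num_arcs D = e ->
            (spectral_radius R D = rho_e <->
             exists H : digraph,
               is_complete_plus_arc k H /\ iso_up_to_isolated D H)) &
          (k = 2%N -> forall D : digraph, num_arcs D = e ->
            (spectral_radius R D = rho_e <->
             iso_up_to_isolated D oriented_triangle \/
             exists H : digraph,
               is_complete_plus_arc 2 H /\ iso_up_to_isolated D H))],
      (* part 3 *)
      e = (k * (k - 1) + 2 * k - 2)%N ->
      let rho_e : R :=
        (k%:R - 2 + Num.sqrt ((k%:R - 2) ^+ 2 + 8 * (k%:R - 1))) / 2 in
      max_spectral_radius e rho_e /\
      (forall D : digraph, num_arcs D = e ->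
        (spectral_radius R D = rho_e <->
         exists u v : 'I_k.+1,
           u != v /\ iso_up_to_isolated D (complete_minus_K2 u v))) &
      (* part 4 *)
      e = (k * (k - 1) + 2 * k - 1)%N ->
      let rho_e : R :=
        (k%:R - 1 + Num.sqrt ((k%:R - 1) ^+ 2 + 4 * (k%:R - 1))) / 2 in
      max_spectral_radius e rho_e /\
      (forall D : digraph, num_arcs D = e ->
        (spectral_radius R D = rho_e <->
         exists u v : 'I_k.+1,
           u != v /\ iso_up_to_isolated D (complete_minus_arc u v)))].
Proof.
case: k hk => // n _; rewrite (_ : (n.+1 - 1 = n)%N); last by rewrite subn1.
have nE : n.+1%:R - 1 = n%:R :> R by rewrite -natr1 addrK.
split.
- by move=> -> rho_e; rewrite /rho_e nE; apply: extremal_complete.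
- move=> -> rho_e; rewrite /rho_e nE; case: n nE {rho_e} => [|n] nE.
    by split=> //; apply: max_spectral_radius_one_arc.
  have [maxr rhoP] := @extremal_complete_plus_arc R n.+1 isT; split=> //.
    move=> n2 D /rhoP ->; split=> [[[n1]|//]|]; last by right.
    by rewrite n1 in n2.
  move=> [n0] D /rhoP ->; rewrite n0.
  by split=> [[[_]|]|[]]; [left|right|left|right].
(* For [k = 1] there is no arc, and the radius 0 is attained by all digraphs. *)
- case: n nE => [|n] nE -> rho_e; last first.
    by apply: extremal_complete_minus_K2 => //; nia.
  have -> : rho_e = 0.
    rewrite /rho_e subrr mulr0 addr0 sqrtr_sqr (_ : 1 - 2 = -1); last by lra.
    by rewrite normrN1; lra.
  have [max0 rho0] := @extremal_complete R 0; split=> // D D0; split=> _.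
    exists ord0, ord_max; split; first by rewrite -val_eqE.
    apply: iso_of_arcless => //.
    by have := @num_arcs_complete_minus_K2 2 ord0 ord_max isT; lia.
  by apply/rho0 => //; apply: iso_of_arcless => //; rewrite num_arcs_complete.
(* For [k = 1] there is one arc, and all digraphs with one arc are isomorphic up
   to isolated vertices. *)
case: n nE => [|n] nE -> rho_e; last first.
  by apply: extremal_complete_minus_arc => //; nia.
have -> : rho_e = 0.
  by rewrite /rho_e subrr mulr0 addr0 expr0n sqrtr0 addr0 mul0r.
have max0 := max_spectral_radius_one_arc R; split=> // D D1; split=> _.
  exact: iso_complete_minus_arc_of_one_arc.
by apply/le_anti; rewrite spectral_radius_ge0 (proj2 max0).
Qed.
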